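(* Fix an integer $k\ge 3$. Let $\Omega=[N]$ or $\Omega=\mathbb{Z}/N\mathbb{Z}$ ($N$ not necessarily prime). Let $p=p_N\in(0,1)$ with $p\to0$ and $\delta=\delta_N>0$ be such that $\delta=O(1)$, $\delta p^kN^2\to\infty$, and $\delta^{-3}p^{k-2}(\log(1/p))^2\to0$. Then, as $N\to\infty$, $$\phi_p^{(k,\Omega)}(\delta)=(1+o(1))\,\log(1/p)\cdot\min_{S\subset\Omega}\big\{|S| : T_k(S)\ge\delta p^kT_k(\Omega)\big\}.$$
   Context: $[N]=\{1,\dots,N\}$. The ambient group is $\mathbb{Z}$ if $\Omega=[N]$ and $\mathbb{Z}/N\mathbb{Z}$ if $\Omega=\mathbb{Z}/N\mathbb{Z}$. For a subset $A$ of the ambient group, $T_k(A)$ is the number of pairs $(a,b)$ of elements of the ambient group with $a,a+b,\dots,a+(k-1)b\in A$ (so $b=0$ and negative differences are allowed). For $f:\Omega\to\mathbb{R}$, $T_k(f)=\sum_{a,b} f(a)f(a+b)\cdots f(a+(k-1)b)$, the sum over pairs $(a,b)$ in the ambient group with $\{a,a+b,\dots,a+(k-1)b\}\subset\Omega$. $I_p(x)=x\log\frac{x}{p}+(1-x)\log\frac{1-x}{1-p}$ for $x\in[0,1]$ (with $0\log 0=0$), and $$\phi_p^{(k,\Omega)}(\delta)=\inf_{f:\Omega\to[0,1]}\Big\{\sum_{a\in\Omega}I_p(f(a)) : T_k(f)\ge(1+\delta)p^kT_k(\Omega)\Big\}.$$ *)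

(* Defs.v *)
From HB Require Import structures.
From mathcomp Require Import all_boot all_order all_algebra finmap.
From mathcomp Require Import all_classical all_reals all_analysis.

Set Implicit Arguments.
Unset Strict Implicit.
Unset Printing Implicit Defensive.

Import Order.TTheory GRing.Theory Num.Theory.
Import numFieldNormedType.Exports.

Local Open Scope classical_set_scope.
Local Open Scope ring_scope.

(* The pairs (a, b), trivial and negative differences included, such that
   a, a + b, ..., a + (k - 1) b all lie in A.  When k >= 2 this set is finite
   in every abelian group, so fset_set returns it; for k < 2 and G infinite
   fset_set may return the empty set. *)
Definition progressions (k : nat) (G : zmodType) (A : {fset G}) :
    {fset G * G} :=
  fset_set [set ab : G * G | forall i : 'I_k, ab.1 + ab.2 *+ i \in A].

Definition T_set (k : nat) (G : zmodType) (A : {fset G}) : nat :=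
  #|` progressions k A|.

(* A function Omega -> R is represented by a function on the whole ambient
   group, of which only the values on Omega are used. *)
Definition T_fun (R : realType) (k : nat) (G : zmodType) (Omega : {fset G})
    (f : G -> R) : R :=
  \sum_(ab <- progressions k Omega) \prod_(i < k) f (ab.1 + ab.2 *+ i).

(* The convention 0 log 0 = 0 holds because the product with 0 is 0. *)
Definition rel_entropy (R : realType) (p x : R) : R :=
  x * ln (x / p) + (1 - x) * ln ((1 - x) / (1 - p)).

(* Extended-real valued, so that an infimum over no function is +oo. *)
Definition phi (R : realType) (k : nat) (G : zmodType) (Omega : {fset G})
    (p delta : R) : \bar R :=
  ereal_inf [set (\sum_(a <- Omega) rel_entropy p (f a))%:E | f in
    [set f : G -> R | (forall a, a \in Omega -> 0 <= f a <= 1) /\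
      (1 + delta) * p ^+ k * (T_set k Omega)%:R <= T_fun k Omega f]].

(* The least |S| over S included in Omega with T_k(S) >= t; +oo if there is
   no such S. *)
Definition min_size (R : realType) (k : nat) (G : zmodType) (Omega : {fset G})
    (t : R) : \bar R :=
  \big[Order.min/+oo%E]_(S <- fpowerset Omega | t <= (T_set k S)%:R)
    (#|` S|%:R)%:E.

Inductive setting := IntegerInterval | CyclicGroup.

(* 'I_N.-1.+1 is Z/NZ for every N >= 1 (unlike 'Z_N, which is Z/2Z at N = 1). *)
Definition ambient (c : setting) (N : nat) : zmodType :=
  match c with
  | IntegerInterval => int
  | CyclicGroup => 'I_N.-1.+1
  end.

Definition Omega (c : setting) (N : nat) : {fset ambient c N} :=
  match c return {fset ambient c N} with
  | IntegerInterval => [fset Posz n | n in iota 1 N]%fset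
  | CyclicGroup => [fset x | x in 'I_N.-1.+1]%fset
  end.

(* Main.v *)
(* Upper bound: put f = 1 on an extremal set S and f = p / (1 - delta p^k)
   elsewhere; the slight increase outside S costs a negligible amount of entropy.

   Lower bound: let t = delta p^k T_k(Omega).  If the entropy of f is at most
   log(1/p) times the minimal size, which is O(sqrt t), then
   I_p(x) >= s (x - p) - p s^2 with s a small multiple of delta shows that
   sum (f - p)_+ = o(delta p N); here delta^-3 p^(k-2) log(1/p)^2 -> 0 is used.
   A progression on which at most one value of f exceeds 2p therefore
   contributes, beyond p^k, only o(t) in total.  One with two such values and
   some value below tau = log(1/p)^-3 also contributes o(t), because two terms
   determine a progression up to k choices and the values above 2p have sum
   O(log(1/p) sqrt t).  Hence h = f 1[f > tau] has T_k(h) >= (1 - o(1)) t, while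
   sum I_p(f) >= (1 - o(1)) log(1/p) sum h.

   Finally h is rounded to a set S with |S| <= (1 + o(1)) sum h and
   T_k(S) >= (1 - o(1)) t; this needs sum h of order sqrt t to be large, hence
   delta p^k N^2 -> oo.  Adding to S an interval of length o(sqrt t) in which S
   is sparse brings T_k up to t. *)
Require Import Defs.
From HB Require Import structures.
From mathcomp Require Import all_boot all_order all_algebra finmap.
From mathcomp Require Import all_classical all_reals all_analysis.
From mathcomp Require Import zify ring lra.

Set Implicit Arguments.
Unset Strict Implicit.
Unset Printing Implicit Defensive.

Import Order.TTheory GRing.Theory Num.Theory.
Import numFieldNormedType.Exports.

Local Open Scope classical_set_scope.
Local Open Scope ring_scope.

(** * Counting progressions *)

(** For [k >= 2] a progression is determined by its first two terms, so the pairs lie in the image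
    of [A x A] under [(x, y) -> (x, y - x)]; the set is finite and [fset_set] loses nothing. *)
Lemma mem_progressions (k : nat) (G : zmodType) (A : {fset G}) (ab : G * G) :
  (1 < k)%N ->
  (ab \in progressions k A) = [forall i : 'I_k, ab.1 + ab.2 *+ i \in A].
Proof.
move=> k1; rewrite /progressions in_fset_set.
  by apply/idP/forallP => [/set_mem|h]; rewrite ?inE.
pose B := (A `*` A)%fset.
apply: (@sub_finite_set _ _ ((fun xy : G * G => (xy.1, xy.2 - xy.1)) @` [set` B])).
  move=> [a b] /= h; exists (a, a + b); last by rewrite /= addrC addrA addNr add0r.
  rewrite /= /B in_fsetE /=; apply/andP; split.
    by have := h (Ordinal (ltnW k1)); rewrite mulr0n addr0.
  by have := h (Ordinal k1).
exact/finite_image/finite_fset.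
Qed.

Lemma sumr_count (R : realType) (T : choiceType) (A : {fset T}) (P : pred T) :
  \sum_(x <- A) (P x)%:R = #|` [fset x in A | P x]%fset|%:R :> R.
Proof.
by rewrite -natr_sum -big_mkcond /= big_fset_condE /= sum1_size.
Qed.

Lemma natr_forall (R : realType) (k : nat) (P : pred 'I_k) :
  \prod_(i < k) (P i)%:R = ([forall i, P i] : bool)%:R :> R.
Proof.
case: (boolP [forall i, P i]) => [/forallP h|].
  by rewrite big1 // => i _; rewrite h.
rewrite negb_forall => /existsP[i hi].
by rewrite (bigD1 i) //= (negbTE hi) mul0r.
Qed.

Lemma T_fun_indicator (R : realType) (k : nat) (G : zmodType) (W A : {fset G}) :
  (1 < k)%N -> (A `<=` W)%fset ->
  T_fun k W (fun x => (x \in A)%:R) = (T_set k A)%:R :> R.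
Proof.
move=> k1 /fsubsetP AW; rewrite /T_fun /T_set.
under eq_bigr do rewrite natr_forall.
rewrite sumr_count; congr (#|` _|)%:R; apply/fsetP => ab.
rewrite !inE /= !mem_progressions //; apply: andb_idl => /forallP h.
by apply/forallP => i; apply: AW.
Qed.

Lemma T_fun_const (R : realType) (k : nat) (G : zmodType) (W : {fset G}) (x : R) :
  T_fun k W (fun=> x) = x ^+ k * (T_set k W)%:R.
Proof.
rewrite /T_fun; under eq_bigr do rewrite prodr_const card_ord.
by rewrite big_const_seq count_predT iter_addr_0 mulr_natr.
Qed.

Lemma eq_T_fun (R : realType) (k : nat) (G : zmodType) (W : {fset G}) (f g : G -> R) :
  (1 < k)%N -> {in W, f =1 g} -> T_fun k W f = T_fun k W g.
Proof.
move=> k1 fg; rewrite /T_fun; apply: eq_big_seq => ab.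
by rewrite mem_progressions // => /forallP h; apply: eq_bigr => i _; rewrite fg.
Qed.

(* [pt] parametrizes [Omega] by an initial segment of [nat] in such a way that
   integer progressions are mapped to progressions; [df] does the same for
   their common differences. *)
Record ap_frame (k N : nat) (G : zmodType) (W : {fset G}) := APFrame {
  pt : nat -> G;
  df : nat -> G;
  ptD : forall a b i, pt (a + b * i) = pt a + df b *+ i;
  pt_inj : {in gtn N &, injective pt};
  df_inj : {in gtn N &, injective df};
  pt_mem : forall n, (n < N)%N -> pt n \in W;
  card_frame : #|` W| = N;
  fibre_le : forall (B : {fset G}) d y, (0 < d < k)%N ->
    {in B, forall b, b *+ d = y} -> (#|` B| <= k)%N }.

Lemma sum_delta (R : realType) (G : choiceType) (W : {fset G}) (x : G) (g : G -> R) :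
  x \in W -> \sum_(u <- W) (x == u)%:R * g u = g x.
Proof.
move=> xW; rewrite (big_fsetD1 x) //= eqxx mul1r big1_fset ?addr0 // => u.
by rewrite !inE eq_sym => /andP[/negbTE-> _] _; rewrite mul0r.
Qed.

(** * Counting progressions with prescribed terms *)

Section Frame.
Variables (R : realType) (k N : nat) (G : zmodType) (W : {fset G}).
Hypothesis k1 : (1 < k)%N.
Variable F : ap_frame k N W.

(** Once [b] is known, the term [u] fixes [a]; and [(j - i) b = v - u] leaves at most [k] choices of
    [b] by [fibre_le]. In [Z/NZ] with [N] composite there can be several. *)
Lemma card_two_terms (i j : 'I_k) (u v : G) : i != j ->
  (#|` [fset ab in progressions k W | (ab.1 + ab.2 *+ i == u)%R &&
        (ab.1 + ab.2 *+ j == v)%R]%fset| <= k)%N.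
Proof.
move=> ij; set X := [fset ab in _ | _]%fset.
have inj : {in X &, injective (@snd G G)}.
  move=> [a b] [a' b']; rewrite !inE /= => /andP[_ /andP[/eqP h _]].
  move=> /andP[_ /andP[/eqP h' _]] bb'; rewrite -bb' in h' *.
  by congr pair; apply: (addIr (b *+ i)); rewrite h h'.
have <- : #|` (@snd G G @` X)%fset| = #|` X| by rewrite card_in_imfset.
have E b : b \in (@snd G G @` X)%fset -> b *+ j - b *+ i = v - u.
  move=> /imfsetP[[a b0] /=]; rewrite !inE /= => /andP[_ /andP[/eqP <- /eqP <-]] ->.
  by rewrite opprD addrACA subrr add0r.
have [lij|lji] : (i < j)%N \/ (j < i)%N.
  by move: ij; rewrite neq_ltn => /orP.
  apply: (@fibre_le _ _ _ _ F _ (j - i)%N (v - u)).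
    by rewrite subn_gt0 lij /= (leq_ltn_trans (leq_subr _ _)).
  by move=> b /E <-; rewrite mulrnBr // ltnW.
apply: (@fibre_le _ _ _ _ F _ (i - j)%N (u - v)).
  by rewrite subn_gt0 lji /= (leq_ltn_trans (leq_subr _ _)).
by move=> b /E bE; rewrite mulrnBr ?(ltnW lji) // -[LHS]opprB bE opprB.
Qed.

(** Sorting the progressions by the values [(u, v)] of the two terms gives a double sum over [W]
    whose multiplicities are at most [k]. *)
Lemma sum_two_terms (g1 g2 : G -> R) (i j : 'I_k) : i != j ->
  {in W, forall x, 0 <= g1 x} -> {in W, forall x, 0 <= g2 x} ->
  \sum_(ab <- progressions k W) g1 (ab.1 + ab.2 *+ i) * g2 (ab.1 + ab.2 *+ j)
    <= k%:R * (\sum_(x <- W) g1 x) * (\sum_(x <- W) g2 x).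
Proof.
move=> ij g10 g20.
have -> : \sum_(ab <- progressions k W)
     g1 (ab.1 + ab.2 *+ i) * g2 (ab.1 + ab.2 *+ j) =
   \sum_(u <- W) \sum_(v <- W) (\sum_(ab <- progressions k W)
     ((ab.1 + ab.2 *+ i == u) && (ab.1 + ab.2 *+ j == v))%:R) * (g1 u * g2 v).
  transitivity (\sum_(ab <- progressions k W) \sum_(u <- W) \sum_(v <- W)
     ((ab.1 + ab.2 *+ i == u) && (ab.1 + ab.2 *+ j == v))%:R * (g1 u * g2 v)).
    apply: eq_big_seq => ab; rewrite mem_progressions // => /forallP h.
    rewrite -(sum_delta g1 (h i)) mulr_suml; apply: eq_bigr => u _.
    rewrite -(sum_delta g2 (h j)) mulr_sumr; apply: eq_bigr => v _.
    by rewrite -mulnb natrM; ring.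
  rewrite exchange_big /=; apply: eq_bigr => u _.
  rewrite exchange_big /=; apply: eq_bigr => v _.
  by rewrite mulr_suml.
rewrite -mulrA mulr_suml mulr_sumr big_seq [leRHS]big_seq.
apply: ler_sum => u uW; rewrite mulr_sumr mulr_sumr.
rewrite big_seq [leRHS]big_seq; apply: ler_sum => v vW.
by rewrite sumr_count ler_wpM2r ?mulr_ge0 ?g10 ?g20 // ler_nat card_two_terms.
Qed.

Lemma sum_one_term (g : G -> R) (i : 'I_k) : {in W, forall x, 0 <= g x} ->
  \sum_(ab <- progressions k W) g (ab.1 + ab.2 *+ i)
    <= k%:R * N%:R * (\sum_(x <- W) g x).
Proof.
move=> g0.
have [j ij] : exists j : 'I_k, i != j.
  case: (eqVneq (i : nat) 0%N) => i0.
    by exists (Ordinal k1); rewrite -val_eqE /= i0.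
  by exists (Ordinal (ltnW k1)); rewrite -val_eqE /=.
have := @sum_two_terms g (fun=> 1) i j ij g0 (fun _ _ => ler01).
under eq_bigr do rewrite mulr1.
by rewrite big_const_seq count_predT iter_addr_0 (card_frame F) mulrAC.
Qed.

Lemma sum_fset1 (A : {fset G}) : (A `<=` W)%fset ->
  \sum_(x <- W) (x \in A)%:R = #|` A|%:R :> R.
Proof.
move=> /fsubsetP AW; rewrite sumr_count; congr (#|` _|)%:R.
by apply/fsetP => x; rewrite !inE andbC; case: (boolP (x \in A)) => //= /AW.
Qed.

Lemma T_set_le (A : {fset G}) : (A `<=` W)%fset ->
  (T_set k A)%:R <= k%:R * #|` A|%:R ^+ 2 :> R.
Proof.
move=> AW; rewrite -(@T_fun_indicator R k G W) // /T_fun.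
pose i0 := Ordinal (ltnW k1); pose i1 := Ordinal k1.
have := @sum_two_terms (fun x => (x \in A)%:R) (fun x => (x \in A)%:R) i0 i1 isT
  (fun _ _ => ler0n _ _) (fun _ _ => ler0n _ _).
rewrite sum_fset1 // -mulrA -expr2; apply: le_trans; apply: ler_sum => ab _.
rewrite natr_forall -natrM mulnb ler_nat; case: forallP => //= h.
by rewrite lt0b (h i0) (h i1).
Qed.

(** The [(r + 1)^2] pairs with first term [u + x] and difference [y], where [x, y <= r], all
    qualify, since their terms are at most [u + r + r (k - 1) = u + r k]. They are distinct because
    [pt] and [df] are injective below [N]. *)
Lemma T_set_ge (A : {fset G}) (u r : nat) : (u + r * k < N)%N ->
  (forall n, (n <= r * k)%N -> pt F (u + n) \in A) ->
  (r.+1 ^ 2 <= T_set k A)%N.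
Proof.
move=> uN hA; rewrite /T_set.
pose P := [seq (x, y) | x <- iota 0 r.+1, y <- iota 0 r.+1].
pose m (xy : nat * nat) := (pt F (u + xy.1), df F xy.2).
have mP xy : xy \in P -> (xy.1 <= r)%N && (xy.2 <= r)%N.
  by move=> /allpairsP[xy' [+ + ->]]; rewrite !mem_iota !add0n !ltnS => /andP[_ ->].
have uP : uniq P by rewrite allpairs_uniq ?iota_uniq // => -[? ?] [? ?].
have um : uniq (map m P).
  rewrite map_inj_in_uniq // => -[x y] [x' y'] /mP/=/andP[xr yr] /mP/=/andP[xr' yr'].
  have H n : (n <= r)%N -> (u + n < N)%N.
    by move=> nr; apply: leq_ltn_trans uN; rewrite leq_add2l (leq_trans nr) // leq_pmulr // ltnW.
  have H' n : (n <= r)%N -> (n < N)%N.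
    by move=> nr; apply: leq_ltn_trans (H _ nr); rewrite leq_addl.
  move=> [/(pt_inj (H _ xr) (H _ xr'))/addnI -> /(df_inj (H' _ yr) (H' _ yr')) ->] //.
have -> : (r.+1 ^ 2)%N = size (map m P).
  by rewrite size_map size_allpairs !size_iota -mulnn.
apply: uniq_leq_size um _ => ab /mapP[xy /mP/andP[xr yr] ->].
rewrite mem_progressions //; apply/forallP => i /=.
rewrite -ptD -addnA hA //.
have -> : (r * k = r + r * k.-1)%N by rewrite -mulnS prednK // ltnW.
by rewrite leq_add // leq_mul // -ltnS prednK // ltnW.
Qed.

(** A progression counted both in [S] and in [I] has one term in the intersection and another in
    [I]; [sum_two_terms] bounds the number of these. *)
Lemma T_setUD (S I : {fset G}) : (S `<=` W)%fset -> (I `<=` W)%fset ->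
  (T_set k S)%:R + (T_set k I)%:R
    - k%:R ^+ 2 * #|` S `&` I|%fset%:R * #|` I|%:R
    <= (T_set k (S `|` I)%fset)%:R :> R.
Proof.
move=> SW IW.
have UW : (S `|` I `<=` W)%fset by rewrite fsubUset SW.
have CW : (S `&` I `<=` W)%fset by rewrite (fsubset_trans (fsubsetIl _ _)).
rewrite -!(@T_fun_indicator R k G W) // lerBlDr.
(* [j i] is just some index different from [i]. *)
pose j (i : 'I_k) := if (i : nat) == 0%N then Ordinal k1 else Ordinal (ltnW k1).
have ij i : i != j i.
  by rewrite -val_eqE /j /=; case: (eqVneq (i : nat) 0%N) => [->|].
pose E ab : R := \sum_(i < k)
  (ab.1 + ab.2 *+ i \in (S `&` I)%fset)%:R * (ab.1 + ab.2 *+ j i \in I)%:R.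
apply: (@le_trans _ _ (T_fun k W (fun x => (x \in (S `|` I)%fset)%:R) +
    \sum_(ab <- progressions k W) E ab)); last first.
  rewrite lerD2l /E exchange_big /=.
  apply: le_trans (_ : \sum_(i < k) k%:R * #|` S `&` I|%fset%:R * #|` I|%:R <= _).
    apply: ler_sum => i _.
    have := @sum_two_terms (fun x => (x \in (S `&` I)%fset)%:R)
      (fun x => (x \in I)%:R) i (j i) (ij i)
      (fun _ _ => ler0n _ _) (fun _ _ => ler0n _ _).
    by rewrite !sum_fset1.
  by rewrite sumr_const card_ord -[leLHS]mulr_natl expr2 !mulrA.
rewrite /T_fun -!big_split /=; apply: ler_sum => ab _.
rewrite !natr_forall.
have E0 : 0 <= E ab by apply: sumr_ge0 => i _; rewrite mulr_ge0.
case: (boolP [forall i, _ \in S]) => [/forallP hS|hS].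
  have -> : [forall i : 'I_k, (ab.1 + ab.2 *+ i)%R \in (S `|` I)%fset].
    by apply/forallP => i; rewrite inE hS.
  rewrite lerD2l; case: (boolP [forall i, _ \in I]) => // /forallP hI.
  rewrite /E (bigD1 (Ordinal k1)) // inE (hS (Ordinal k1)) !hI mulr1 lerDl.
  by apply: sumr_ge0 => i _; rewrite mulr_ge0.
rewrite add0r; case: (boolP [forall i, _ \in I]) => [/forallP hI|_].
  have -> : [forall i : 'I_k, (ab.1 + ab.2 *+ i)%R \in (S `|` I)%fset].
    by apply/forallP => i; rewrite inE hI orbT.
  by rewrite lerDl.
by rewrite addr_ge0.
Qed.

(** * Enlarging a set by a sparse interval *)

Definition block (l j : nat) : {fset G} :=
  [fset pt F n | n in iota (j * l) l]%fset.

Lemma card_block (l j : nat) : (#|` block l j| <= l)%N.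
Proof.
rewrite -[leqRHS](size_iota (j * l)) /block.
apply: leq_trans (leq_imfset_card _ _ _) _.
by apply: uniq_leq_size (enum_finmem_uniq _) _ => n; rewrite enum_finmemE.
Qed.

Lemma block_sub (l j : nat) : (j.+1 * l <= N)%N -> (block l j `<=` W)%fset.
Proof.
move=> jN; apply/fsubsetP => x /imfsetP[n /=]; rewrite mem_iota => /andP[_ nl] ->.
by apply: pt_mem; apply: leq_trans nl _; rewrite addnC -mulSn.
Qed.

(** Averaging: the [N %/ l] blocks are disjoint, so the one that meets [S] least holds at most the
    average share of [S]. *)
Lemma sparse_block (S : {fset G}) (l : nat) : (0 < l <= N)%N ->
  exists2 j, (j.+1 * l <= N)%N &
    (#|` S `&` block l j|%fset * (N %/ l) <= #|` S|)%N.
Proof.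
move=> /andP[l0 lN].
have n0 : (0 < N %/ l)%N by rewrite divn_gt0.
have jN j : (j < N %/ l)%N -> (j.+1 * l <= N)%N.
  by move=> jn; rewrite (leq_trans (leq_mul jn (leqnn l))) // leq_divM.
case: (arg_minnP (fun j : 'I_(N %/ l) => #|` S `&` block l j|%fset)
  (isT : predT (Ordinal n0))) => j _ jmin.
exists j; first exact: jN.
apply: (@leq_trans (\sum_(j' < N %/ l) #|` S `&` block l j'|%fset)).
  rewrite mulnC -[X in (X * _)%N]card_ord -sum_nat_const.
  by apply: leq_sum => j' _; apply: jmin.
rewrite -(ler_nat R) natr_sum.
have E (A : {fset G}) : #|` S `&` A|%fset%:R = \sum_(x <- S) (x \in A)%:R :> R.
  by rewrite sumr_count; congr (#|` _|)%:R; apply/fsetP => x; rewrite !inE.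
under eq_bigr do rewrite E.
rewrite exchange_big /=.
rewrite -[leRHS]mulr1n.
have -> : #|` S|%:R *+ 1 = \sum_(x <- S) 1 :> R.
  by rewrite big_const_seq count_predT iter_addr_0.
apply: ler_sum => x _; rewrite -natr_sum lern1.
case: (boolP [exists j' : 'I_(N %/ l), x \in block l j']) => [/existsP[j' hj']|]; last first.
  by rewrite negb_exists => /forallP h; rewrite big1 // => i _; rewrite (negbTE (h i)).
rewrite (bigD1 j') //= hj' big1 // => i ij'; apply/eqP; rewrite eqb0.
apply: contra ij' => hi; apply/eqP/val_inj => /=.
have [n nj' xn] : exists2 n, n \in iota (j' * l) l & x = pt F n.
  by case/imfsetP: hj' => n /= nl ->; exists n.
have [m mi xm] : exists2 n, n \in iota (i * l) l & x = pt F n.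
  by case/imfsetP: hi => n' /= nl ->; exists n'.
move: nj' mi; rewrite !mem_iota => /andP[n1 n2] /andP[m1 m2].
have bd i' q : (i' < N %/ l)%N -> (q < i' * l + l)%N -> (q < N)%N.
  by move=> ii qi; apply: leq_trans (jN _ ii); rewrite mulSn addnC.
have nm : n = m.
  by apply: (pt_inj (a0 := F)); rewrite ?inE ?(bd _ _ (ltn_ord _) n2)
     ?(bd _ _ (ltn_ord _) m2) -?xn -?xm.
have Q i' q : (i' * l <= q)%N -> (q < i' * l + l)%N -> i' = (q %/ l)%N.
  move=> h1 h2; rewrite -(subnK h1) addnC divnMDl // divn_small ?addn0 //.
  by rewrite ltn_subLR.
by rewrite (Q _ _ m1 m2) (Q _ _ n1 n2) nm.
Qed.

(** [T_set_ge] applies with [r = (l - 1) %/ k], for which [k (r + 1) >= l]. *)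
Lemma T_block (l j : nat) : (0 < l)%N -> (j.+1 * l <= N)%N ->
  l%:R ^+ 2 <= k%:R ^+ 2 * (T_set k (block l j))%:R :> R.
Proof.
move=> l0 jN.
have h : ((l.-1 %/ k).+1 ^ 2 <= T_set k (block l j))%N.
  have rl : (l.-1 %/ k * k <= l.-1)%N by rewrite leq_divM.
  apply: (@T_set_ge _ (j * l)) => [|n nr].
    apply: leq_trans jN; rewrite mulSn [ltnRHS]addnC -addnS leq_add2l.
    by rewrite -[ltnRHS](prednK l0) ltnS.
  apply/imfsetP; exists (j * l + n)%N => //=.
  by rewrite mem_iota leq_addr ltn_add2l (leq_ltn_trans (leq_trans nr rl)) // ltn_predL.
rewrite -!natrX -natrM ler_nat; apply: leq_trans (leq_mul (leqnn _) h).
rewrite -expnMn leq_sqr mulnC.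
have := @ltn_ceil l.-1 k (ltnW k1).
by rewrite prednK.
Qed.

(** A sparse block brings at least [l^2 / k^2] progressions of its own. Since [S] is small, it meets
    the block in at most [l / (2 k^4)] points, so the correction in [T_setUD] costs at most half of
    that gain. *)
Lemma enlarge (S : {fset G}) (l : nat) : (S `<=` W)%fset -> (0 < l <= N)%N ->
  4 * k%:R ^+ 4 * #|` S|%:R <= N%:R :> R ->
  exists S' : {fset G}, [/\ (S' `<=` W)%fset, (#|` S'| <= #|` S| + l)%N &
    (T_set k S)%:R + l%:R ^+ 2 / (2 * k%:R ^+ 2) <= (T_set k S')%:R :> R].
Proof.
move=> SW lN Ssmall; have /andP[l0 lN'] := lN.
have [j jN hj] := sparse_block S lN.
exists (S `|` block l j)%fset; split.
- by rewrite fsubUset SW block_sub.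
- rewrite cardfsU (leq_trans (leq_subr _ _)) // leq_add2l; exact: card_block.
apply: le_trans (T_setUD SW (block_sub jN)).
rewrite -addrA lerD2l.
have kR : 0 < k%:R :> R by rewrite ltr0n ltnW.
have lR : 0 < l%:R :> R by rewrite ltr0n.
have Tl := T_block l0 jN.
set T := (T_set k (block l j))%:R in Tl *.
set s : R := #|` S `&` block l j|%fset%:R.
have s0 : 0 <= s :> R by [].
have lcard : #|` block l j|%:R <= l%:R :> R by rewrite ler_nat card_block.
(* [N / l] exceeds [N / (2 l)], since [l <= N] *)
have hs : s * N%:R <= 2 * l%:R * #|` S|%:R :> R.
  rewrite -!natrM ler_nat.
  have h1 := divn_eq N l; have h2 : (N %% l < l)%N by rewrite ltn_mod.
  have h3 : (0 < N %/ l)%N by rewrite divn_gt0.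
  rewrite {1}h1 mulnDr.
  rewrite (_ : 2 * l * #|` S| = l * #|` S| + l * #|` S|)%N; last by lia.
  apply: leq_add; first by rewrite mulnA mulnC leq_mul.
  apply: (@leq_trans (#|` (S `&` block l j)%fset| * (l * (N %/ l)))%N).
    by rewrite leq_mul // (leq_trans (ltnW h2)) // leq_pmulr.
  by rewrite mulnCA leq_mul.
have hs' : 2 * k%:R ^+ 4 * s <= l%:R.
  have N0 : 0 < N%:R :> R by rewrite ltr0n (leq_trans l0).
  rewrite -(ler_pM2r N0) -[leLHS]mulrA.
  apply: (@le_trans _ _ (2 * k%:R ^+ 4 * (2 * l%:R * #|` S|%:R))).
    by rewrite ler_wpM2l // mulr_ge0 // exprn_ge0 // ltW.
  rewrite (_ : _ * _ = l%:R * (4 * k%:R ^+ 4 * #|` S|%:R)); last by ring.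
  by rewrite ler_wpM2l // ltW.
rewrite ler_pdivrMr; last by rewrite mulr_gt0 // exprn_gt0.
apply: (@le_trans _ _ (2 * (k%:R ^+ 2 * T) - (2 * k%:R ^+ 4 * s) * l%:R)).
  have : (2 * k%:R ^+ 4 * s) * l%:R <= l%:R * l%:R by rewrite ler_wpM2r // ltW.
  by move: Tl; rewrite expr2; lra.
rewrite mulrBl; apply: lerB; first by rewrite le_eqVlt; apply/orP; left; apply/eqP; ring.
rewrite -/s; set b := #|` block l j|%:R in lcard *.
rewrite (_ : _ * _ * b * _ = (2 * k%:R ^+ 4 * s) * b); last by ring.
by rewrite ler_wpM2l // !mulr_ge0 // exprn_ge0 // ltW.
Qed.

End Frame.

(** * Relative entropy *)

Section Entropy.
Variable R : realType.
Implicit Types (a b p x s : R).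

Lemma ln_le_subr1 x : 0 < x -> ln x <= x - 1.
Proof. by move=> x0; have := expR_ge1Dx (ln x); rewrite lnK ?posrE //; lra. Qed.

Lemma mulr_ln_div_ge a b : 0 <= a -> 0 < b -> a - b <= a * ln (a / b).
Proof.
rewrite le_eqVlt => /orP[/eqP <-|a0] b0; first by rewrite mul0r; lra.
have := ln_le_subr1 (divr_gt0 b0 a0).
rewrite -[b / a]invf_div lnV ?posrE ?divr_gt0 // => h.
have {h} : a * (- ln (a / b)) <= a * ((a / b)^-1 - 1) by rewrite ler_pM2l.
by rewrite invf_div mulrBr mulr1 mulrCA divff ?gt_eqF // mulr1; lra.
Qed.

Lemma mulr_ln_div_le a b : 0 <= a -> 0 < b -> a * ln (a / b) <= a * (a / b - 1).
Proof.
rewrite le_eqVlt => /orP[/eqP <-|a0] b0; first by rewrite !mul0r.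
by rewrite ler_pM2l // ln_le_subr1 // divr_gt0.
Qed.

(** The second summand of the entropy is at least [(1 - x) - (1 - p) = p - x]. *)
Lemma rel_entropy_ge_ln p x : 0 < p < 1 -> 0 <= x <= 1 ->
  x * ln (x / p) - x + p <= rel_entropy p x.
Proof.
move=> /andP[p0 p1] /andP[x0 x1]; rewrite /rel_entropy -addrA lerD2l.
have y0 : 0 <= 1 - x by rewrite subr_ge0.
have q0 : 0 < 1 - p by rewrite subr_gt0.
by apply: (le_trans _ (mulr_ln_div_ge y0 q0)); lra.
Qed.

Lemma expR_le_quadratic s : 0 <= s <= 1/4 -> expR s <= 1 + s + s ^+ 2.
Proof.
move=> /andP[s0 s1].
have h := expR_ge1Dx (- (s / 2)).
have h2 : (1 - s / 2) ^+ 2 <= expR (- s).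
  rewrite [in leRHS](_ : - s = - (s / 2) + - (s / 2)); last by field.
  by rewrite expRD -expr2 ler_sqr ?nnegrE ?expR_ge0 //; lra.
have := expRxMexpNx_1 s; have e0 := expR_gt0 s => e1.
have h3 : expR s * (1 - s / 2) ^+ 2 <= 1 by rewrite -[leRHS]e1 ler_pM2l.
(* Together with [e^(-s) >= (1 - s/2)^2] this is the claim; the factor [1 - 3 s + s^2] is positive
   for [s <= 1/4]. *)
have h4 : 1 <= (1 + s + s ^+ 2) * (1 - s / 2) ^+ 2.
  by rewrite -subr_ge0 (_ : _ - 1 = s ^+ 2 / 4 * (1 - 3 * s + s ^+ 2));
     [rewrite mulr_ge0 // ?divr_ge0 // ?sqr_ge0 //; nra | field].
have h5 : 0 < (1 - s / 2) ^+ 2 by rewrite exprn_gt0 //; lra.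
by rewrite -(ler_pM2r h5) (le_trans h3).
Qed.

(* The convex conjugate of [x ln (x / p) - x + p] is [p (e^s - 1)]. *)
Lemma rel_entropy_ge_linear p x s : 0 < p < 1 -> 0 <= x <= 1 -> 0 <= s <= 1/4 ->
  s * (x - p) - p * s ^+ 2 <= rel_entropy p x.
Proof.
move=> p01 x01 s01; apply: le_trans (rel_entropy_ge_ln p01 x01).
have /andP[p0 p1] := p01; have /andP[x0 x1] := x01.
have es := expR_gt0 s.
have h : p * expR s <= p * (1 + s + s ^+ 2) by rewrite ler_pM2l // expR_le_quadratic.
(* Taking [b = p e^s] gives [x ln (x / p) - x + p >= s x - p (e^s - 1)]. *)
have := mulr_ln_div_ge x0 (mulr_gt0 p0 es).
move: x0; rewrite le_eqVlt => /orP[/eqP <-|xgt0].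
  move=> _; have /andP[s0 _] := s01.
  have := mulr_ge0 s0 (ltW p0); have := mulr_ge0 (ltW p0) (sqr_ge0 s).
  by rewrite mul0r; lra.
rewrite invfM mulrA lnM ?posrE ?divr_gt0 ?invr_gt0 // lnV ?posrE // expRK.
by rewrite mulrBr; lra.
Qed.

Lemma rel_entropy_ge0 p x : 0 < p < 1 -> 0 <= x <= 1 -> 0 <= rel_entropy p x.
Proof.
move=> p01 x01; have s01 : 0 <= (0 : R) <= 1/4 by lra.
by apply: le_trans (rel_entropy_ge_linear p01 x01 s01); rewrite mul0r expr0n mulr0 subr0.
Qed.

(** Replacing each [ln y] by [y - 1] gives exactly the right-hand side. *)
Lemma rel_entropy_le_chi2 p x : 0 < p < 1 -> 0 <= x <= 1 ->
  rel_entropy p x <= (x - p) ^+ 2 / (p * (1 - p)).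
Proof.
move=> /andP[p0 p1] /andP[x0 x1]; rewrite /rel_entropy.
have q0 : 0 < 1 - p by rewrite subr_gt0.
have y0 : 0 <= 1 - x by rewrite subr_ge0.
apply: le_trans (lerD (mulr_ln_div_le x0 p0) (mulr_ln_div_le y0 q0)) _.
rewrite le_eqVlt; apply/orP; left; apply/eqP; field.
by rewrite !gt_eqF.
Qed.

End Entropy.

(** * Splitting a progression sum by the size of the values *)

Section Product.
Variables (R : realType) (k : nat) (p tau : R).
Hypotheses (k3 : (3 <= k)%N) (p0 : 0 < p) (ptau : 2 * p <= tau).

Definition excess (x : R) : R := Num.max 0 (x - p).
Definition above (c x : R) : R := (c < x)%R%:R * x.

Lemma excess_ge0 x : 0 <= excess x. Proof. by rewrite /excess le_max lexx. Qed.

Lemma le_excess x : x <= p + excess x.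
Proof. by rewrite -lerBlDl /excess le_max lexx orbT. Qed.

Lemma above_ge0 c x : 0 <= x -> 0 <= above c x.
Proof. by move=> x0; rewrite mulr_ge0. Qed.

(** One factor at a time is replaced by [p + excess], the other factors being at most [2 p]. The
    extra factor [2 p] on both sides avoids the exponent [size r - 1]. *)
Lemma prod_le_linear (I : Type) (r : seq I) (f : I -> R) :
  (forall i, 0 <= f i <= 2 * p) ->
  2 * p * (\prod_(i <- r) f i) <=
    2 * p * p ^+ size r + (2 * p) ^+ size r * \sum_(i <- r) excess (f i).
Proof.
move=> f01; elim: r => [|i r IH]; first by rewrite !big_nil /= !expr0 mulr0 addr0.
rewrite !big_cons /= !exprSr.
have f0 j : 0 <= f j by case/andP: (f01 j).
have P0 : 0 <= \prod_(j <- r) f j by exact: prodr_ge0.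
have P1 : \prod_(j <- r) f j <= (2 * p) ^+ size r.
  by elim: (r) => [|j r' h]; rewrite ?big_nil // big_cons exprS ler_pM // ?prodr_ge0 //;
     case/andP: (f01 j).
have S0 : 0 <= \sum_(j <- r) excess (f j) by apply: sumr_ge0 => *; exact: excess_ge0.
have g0 := excess_ge0 (f i); have fg := le_excess (f i).
move: P0 P1 IH S0; set P := \prod_(_ <- _) _; set S := \sum_(_ <- _) _.
set a := (2 * p) ^+ _; set b := p ^+ _ => P0 P1 IH S0.
have a0 : 0 <= a by rewrite exprn_ge0 // mulr_ge0 // ltW.
have h1 : f i * P <= (p + excess (f i)) * P by rewrite ler_wpM2r.
have h2 : 2 * p * excess (f i) * P <= 2 * p * excess (f i) * a.
  by rewrite ler_wpM2l // !mulr_ge0 // ltW.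
have h3 : p * (2 * p * P) <= p * (2 * p * b + a * S) by rewrite ler_wpM2l // ltW.
have h4 : 0 <= p * a * S by rewrite !mulr_ge0 // ltW.
have h5 : 2 * p * (f i * P) <= 2 * p * ((p + excess (f i)) * P).
  by rewrite ler_wpM2l // mulr_ge0 // ltW.
apply: le_trans h5 _; nra.
Qed.

Lemma ord_third (i j : 'I_k) : exists q : 'I_k, (q != i) && (q != j).
Proof.
have : (0 < #|~: [set i; j]|)%N.
  rewrite cardsCs finset.setCK card_ord subn_gt0 (leq_ltn_trans _ k3) //.
  by rewrite cards2; case: eqP.
by case/card_gt0P => q; rewrite !inE negb_or => h; exists q.
Qed.

(** If all values exceed [tau], the last term suffices. If some value is at most [tau] and two
    exceed [2 p], the [tau] term does. If at most one exceeds [2 p], the first two terms do. *)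
Lemma prod_le_split (f : 'I_k -> R) : (forall i, 0 <= f i <= 1) ->
  \prod_i f i <= p ^+ k + 2 * (2 * p) ^+ k.-1 * (\sum_i excess (f i))
    + tau * (\sum_i \sum_(j | i != j) above (2 * p) (f i) * above (2 * p) (f j))
    + \prod_i above tau (f i).
Proof.
move=> f01.
have f0 i : 0 <= f i by case/andP: (f01 i).
have f1 i : f i <= 1 by case/andP: (f01 i).
have pp0 : 0 < 2 * p by rewrite mulr_gt0.
have tau0 : 0 <= tau by rewrite (le_trans _ ptau) // ltW.
set A := p ^+ k; set B := \sum_i excess _; set C := \sum_i \sum_(_ | _) _.
set D := \prod_i above _ _.
have A0 : 0 <= A by rewrite exprn_ge0 // ltW.
have B0 : 0 <= B by apply: sumr_ge0 => *; exact: excess_ge0.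
have aa0 i j : 0 <= above (2 * p) (f i) * above (2 * p) (f j).
  by rewrite mulr_ge0 // above_ge0.
have C0 : 0 <= C by apply: sumr_ge0 => i _; apply: sumr_ge0.
have D0 : 0 <= D by apply: prodr_ge0 => i _; rewrite above_ge0.
have tC0 : 0 <= tau * C by rewrite mulr_ge0.
set w := (2 * p) ^+ k.-1.
have w0 : 0 <= w by rewrite exprn_ge0 // ltW.
have bB0 : 0 <= 2 * w * B by rewrite !mulr_ge0.
case: (boolP [forall m, tau < f m]) => [/forallP h|].
  suff -> : \prod_i f i = D by lra.
  by apply: eq_bigr => i _; rewrite /above h mul1r.
rewrite negb_forall => /existsP[m]; rewrite -leNgt => mtau.
have three a b c : a != b -> a != c -> b != c -> f a <= tau ->
    2 * p < f b -> 2 * p < f c -> \prod_i f i <= tau * C.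
  move=> ab ac bc fa fb fc.
  rewrite (bigD1 a) //= ler_pM ?prodr_ge0 //.
  apply: (@le_trans _ _ (above (2 * p) (f b) * above (2 * p) (f c))).
    rewrite (bigD1 b) 1?eq_sym //= (bigD1 c) /=; last by rewrite eq_sym ac eq_sym.
    rewrite /above fb fc !mul1r mulrA ler_piMr ?mulr_ge0 //.
    by apply: prodr_ile1 => i _; apply/andP.
  rewrite /C (bigD1 b) //= (bigD1 c) //= -addrA lerDl addr_ge0 //.
    by apply: sumr_ge0.
  by apply: sumr_ge0 => i _; apply: sumr_ge0.
suff [h|h] : \prod_i f i <= tau * C \/ \prod_i f i <= A + 2 * w * B.
- by apply: (le_trans h); lra.
- by apply: (le_trans h); lra.
case: (boolP [exists i, exists j, [&& i != j, 2 * p < f i & 2 * p < f j]]).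
  move=> /existsP[i /existsP[j /and3P[ij fi fj]]]; left.
  (* Here the value at most [tau] is itself one of the two large ones. A third index [q] exists as
     [k >= 3]: either [f q <= tau] and [q] supplies the small value, or [f q > tau >= 2 p] and [q]
     replaces [a] as a large one. *)
  have swap a b : a != b -> 2 * p < f a -> 2 * p < f b -> m = a -> \prod_i f i <= tau * C.
    move=> ab fa fb ma; have [q /andP[qa qb]] := ord_third a b.
    case: (lerP (f q) tau) => fq; first exact: (three q a b).
    apply: (three a q b) => //; last exact: le_lt_trans fq.
      by rewrite eq_sym.
    by rewrite -ma.
  case: (eqVneq m i) => mi; first exact: (swap i j).
  case: (eqVneq m j) => mj; first by apply: (swap j i) => //; rewrite eq_sym.
  exact: (three m i j).
rewrite negb_exists => /forallP H; right.
have {}H i j : i != j -> 2 * p < f i -> f j <= 2 * p.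
  move=> ij fi; have := H i; rewrite negb_exists => /forallP/(_ j).
  by rewrite ij fi /= -leNgt.
case: (boolP [exists i, 2 * p < f i]) => [/existsP[i fi]|].
  rewrite (bigD1 i) //=.
  (* [f i > 2 p] forces [f i <= 2 * excess (f i)]; the other [k - 1] values are at most [2 p]. *)
  apply: (@le_trans _ _ (2 * excess (f i) * w)).
    apply: ler_pM => //; first by apply: prodr_ge0.
      by have := le_excess (f i); lra.
    rewrite /w -[k in k.-1](card_ord k) -(cardC1 i) -prodr_const.
    by apply: ler_prod => j ji; rewrite f0 (H i) // eq_sym.
  rewrite mulrAC -[leLHS]add0r lerD // ler_wpM2l ?mulr_ge0 //.
  by rewrite /B (bigD1 i) //= lerDl sumr_ge0 // => *; exact: excess_ge0.
rewrite negb_exists => /forallP h.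
have hh : 2 * p * (\prod_i f i) <= 2 * p * p ^+ k + (2 * p) ^+ k * B.
  have := @prod_le_linear _ (enum 'I_k) f.
  by rewrite size_enum_ord !big_enum; apply=> i; rewrite f0 leNgt h.
move: hh; rewrite -[in (2 * p) ^+ k](prednK (ltnW (ltnW k3))) exprS -/w.
rewrite -[X in _ + X]mulrA -mulrDr ler_pM2l //.
by rewrite -/A => hh; have := mulr_ge0 w0 B0; lra.
Qed.

End Product.

Section Split.
Variables (R : realType) (k N : nat) (G : zmodType) (W : {fset G}) (p tau : R).
Hypotheses (k3 : (3 <= k)%N) (p0 : 0 < p) (ptau : 2 * p <= tau).
Variable F : ap_frame k N W.

(** Summing [prod_le_split] over all progressions: the [k] one-term sums cost [k N] each, and the at
    most [k^2] two-term sums cost [k] each. *)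
Lemma T_fun_le_split (f : G -> R) : {in W, forall x, 0 <= f x <= 1} ->
  T_fun k W f <= p ^+ k * (T_set k W)%:R
    + 2 * (2 * p) ^+ k.-1 * (k%:R ^+ 2 * N%:R * \sum_(x <- W) excess p (f x))
    + tau * (k%:R ^+ 3 * (\sum_(x <- W) above (2 * p) (f x)) ^+ 2)
    + T_fun k W (fun x => above tau (f x)).
Proof.
move=> f01; have k1 := ltnW k3.
have f0 x : x \in W -> 0 <= f x by move=> /f01/andP[].
pose t (ab : G * G) (i : 'I_k) := f (ab.1 + ab.2 *+ i).
apply: (@le_trans _ _ (\sum_(ab <- progressions k W)
  (p ^+ k + 2 * (2 * p) ^+ k.-1 * (\sum_i excess p (t ab i))
    + tau * (\sum_i \sum_(j | i != j) above (2 * p) (t ab i) * above (2 * p) (t ab j))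
    + \prod_i above tau (t ab i)))).
  rewrite /T_fun big_seq [leRHS]big_seq; apply: ler_sum => ab.
  rewrite mem_progressions // => /forallP h.
  by apply: (prod_le_split k3 p0 ptau) => i; apply: f01.
have pp0 : 0 <= 2 * p by rewrite mulr_ge0 // ltW.
rewrite !big_split /= lerD2r -!mulr_sumr; apply: lerD; first apply: lerD.
- have := @T_fun_const R k G W p; rewrite /T_fun => <-.
  by under [leRHS]eq_bigr do rewrite prodr_const card_ord.
- rewrite ler_wpM2l ?mulr_ge0 ?exprn_ge0 // exchange_big /=.
  apply: (@le_trans _ _ (\sum_(i < k) k%:R * N%:R * \sum_(x <- W) excess p (f x))).
    apply: ler_sum => i _; apply: (sum_one_term k1 F (g := fun x => excess p (f x)) i).
    by move=> x _; exact: excess_ge0.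
  by rewrite sumr_const card_ord -[leLHS]mulr_natl expr2 !mulrA.
- have tau0 : 0 <= tau by exact: le_trans ptau.
  rewrite ler_wpM2l // exchange_big /=.
  set s := \sum_(x <- W) _.
  have s0 : 0 <= s.
    by rewrite /s big_seq; apply: sumr_ge0 => x xW; rewrite above_ge0 // f0.
  apply: (@le_trans _ _ (\sum_(i < k) \sum_(j < k) k%:R * s * s)).
    apply: ler_sum => i _; rewrite exchange_big /=.
    rewrite [leLHS]big_mkcond; apply: ler_sum => j _; case: ifP => ij; last first.
      by rewrite !mulr_ge0.
    by apply: (@sum_two_terms R k N G W k1 F (fun x => above (2 * p) (f x))
       (fun x => above (2 * p) (f x))) => // x xW; rewrite above_ge0 // f0.
  rewrite !sumr_const !card_ord -mulrnA -[leLHS]mulr_natl natrM.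
  by rewrite (_ : _ * _ = k%:R ^+ 3 * s ^+ 2) //; ring.
Qed.

End Split.

(** * Rounding *)

Section Rounding.
Variables (R : realType) (k : nat) (G : zmodType) (W : {fset G}).
Hypothesis k1 : (1 < k)%N.

(** Terms of a progression can coincide, for example when [b = 0], so [h x] may occur in a product
    to a higher power. Such a power is at most [h x], whence an inequality. *)
Lemma T_fun_convex (h : G -> R) (x : G) : {in W, forall y, 0 <= h y <= 1} -> x \in W ->
  T_fun k W h <= (1 - h x) * T_fun k W (fun y => if y == x then 0 else h y)
    + h x * T_fun k W (fun y => if y == x then 1 else h y).
Proof.
move=> h01 xW; rewrite /T_fun !mulr_sumr -big_split /=.
rewrite big_seq [leRHS]big_seq; apply: ler_sum => ab.
rewrite mem_progressions ?k1 // => /forallP hab.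
have hh i := h01 _ (hab i).
case: (boolP [exists i : 'I_k, ab.1 + ab.2 *+ i == x]) => [/existsP[i ix]|].
  rewrite [X in _ <= _ * X + _](bigD1 i) //= ix mul0r mulr0 add0r.
  rewrite (bigD1 i) //= [X in _ <= _ * X](bigD1 i) //= ix mul1r (eqP ix).
  have /andP[hx0 _] := h01 _ xW.
  rewrite ler_wpM2l //; apply: ler_prod => j _.
  by have /andP[h0 h1] := hh j; rewrite h0 /=; case: ifP.
rewrite negb_exists => /forallP hx.
have E (c : R) : \prod_(i < k) (if ab.1 + ab.2 *+ i == x then c else h (ab.1 + ab.2 *+ i))
    = \prod_(i < k) h (ab.1 + ab.2 *+ i).
  by apply: eq_bigr => i _; rewrite (negbTE (hx i)).
by rewrite !E -mulrDl subrK mul1r.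
Qed.

(* [sum h (1 - h) + (sum h - m)^2] is the expectation of [(|S| - m)^2] for a
   random [S] with independent indicators of means [h].  It is affine in each
   coordinate of [h] and [T_fun] is convex in each, so [h] can be rounded one
   coordinate at a time. *)
Lemma rounding (h : G -> R) (lam : R) : 0 <= lam ->
  {in W, forall x, 0 <= h x <= 1} ->
  exists2 S : {fset G}, (S `<=` W)%fset &
    T_fun k W h - lam * (\sum_(x <- W) h x) <=
    (T_set k S)%:R - lam * (#|` S|%:R - \sum_(x <- W) h x) ^+ 2.
Proof.
move=> lam0 h01; set m := \sum_(x <- W) h x.
pose Q (g : G -> R) := T_fun k W g -
  lam * (\sum_(x <- W) g x * (1 - g x) + ((\sum_(x <- W) g x) - m) ^+ 2).
(* The induction is on the list [s] of coordinates still to be rounded; off [s] the function is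
   already 0 or 1. *)
suff round : forall (s : seq G) (g : G -> R), {in W, forall x, 0 <= g x <= 1} ->
    {in W, forall x, x \notin s -> (g x == 0) || (g x == 1)} ->
    exists2 S : {fset G}, (S `<=` W)%fset & Q g <= Q (fun x => (x \in S)%:R).
  (* At the start the deviation from [m] vanishes and the variance is at most [m]. *)
  have hQ : T_fun k W h - lam * m <= Q h.
    rewrite /Q -/m subrr expr0n addr0 lerD2l lerN2 ler_wpM2l //.
    rewrite /m big_seq [leRHS]big_seq; apply: ler_sum => x xW.
    by have /andP[h0 h1] := h01 _ xW; rewrite ler_piMr // gerBl.
  have [x xW|S SW QS] := round W h h01; first by rewrite xW.
  exists S => //; apply: (le_trans hQ); apply: (le_trans QS).
  rewrite /Q T_fun_indicator // sum_fset1 // big1 ?add0r // => x _.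
  by case: (x \in S); rewrite ?subrr ?mulr0 ?mul0r.
elim=> [|x s IH] g g01 gs.
  exists [fset x in W | g x == 1]%fset; first by apply/fsubsetP => x; rewrite !inE => /andP[].
  have E : {in W, g =1 (fun x => (x \in [fset x in W | g x == 1]%fset)%:R)}.
    move=> x xW; have := gs _ xW isT; rewrite !inE xW /=.
    by case/orP => /eqP ->; rewrite ?eqxx // eq_sym oner_eq0.
  rewrite le_eqVlt; apply/orP; left; apply/eqP; rewrite /Q (eq_T_fun k1 E).
  congr (_ - _ * (_ + (_ - _) ^+ 2)).
    by apply: eq_big_seq => x xW; rewrite -E.
  exact: eq_big_seq.
case: (boolP (x \in W)) => xW; last first.
  apply: IH => // y yW ys; apply: gs => //; rewrite inE negb_or ys andbT.
  by apply: contraNneq xW => <-.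
pose u c y := if y == x then c else g y.
have uW c : 0 <= c <= 1 -> {in W, forall y, 0 <= u c y <= 1}.
  by move=> c01 y yW; rewrite /u; case: eqP => // _; apply: g01.
have us c : (c == 0) || (c == 1) ->
    {in W, forall y, y \notin s -> (u c y == 0) || (u c y == 1)}.
  move=> c01 y yW ys; rewrite /u; case: (eqVneq y x) => // yx; apply: gs => //.
  by rewrite inE negb_or ys andbT.
have u00 := uW 0 ltac:(by rewrite lexx ler01).
have u11 := uW 1 ltac:(by rewrite lexx ler01).
have [|S0 S0W h0] := IH _ u00; first by apply: us; rewrite eqxx.
have [|S1 S1W h1] := IH _ u11; first by apply: us; rewrite eqxx orbT.
have Qconv : Q g <= (1 - g x) * Q (u 0) + g x * Q (u 1).
  (* [c] and [t] collect the other coordinates. The [v^2] in [v (1 - v)] cancels that in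
     [(v + t - m)^2]. *)
  have [c [t]] : exists c t, forall v, Q (u v) = T_fun k W (u v) -
      lam * (v * (1 - v) + c + (v + t - m) ^+ 2).
    exists (\sum_(y <- (W `\ x)%fset) g y * (1 - g y)), (\sum_(y <- (W `\ x)%fset) g y) => v.
    rewrite /Q; congr (_ - _ * (_ + (_ - _) ^+ 2)); rewrite (big_fsetD1 x) //=;
      rewrite {1}/u eqxx ?{1}/u ?eqxx; congr (_ + _);
      apply: eq_big_seq => y; rewrite !inE => /andP[/negbTE yx _]; by rewrite /u yx.
  have Eg : Q g = Q (u (g x)).
    by congr Q; apply/funext => y; rewrite /u; case: eqP => // ->.
  move=> E; rewrite Eg !E; have := T_fun_convex g01 xW.
  rewrite -/(u 0) -/(u 1).
  have -> : T_fun k W (u (g x)) = T_fun k W g.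
    by congr T_fun; apply/funext => y; rewrite /u; case: eqP => // ->.
  set T0 := T_fun k W (u 0); set T1 := T_fun k W (u 1); set v := g x => hc.
  apply: le_trans (lerD hc (lexx _)) _.
  by rewrite le_eqVlt; apply/orP; left; apply/eqP; ring.
have /andP[g0 g1] := g01 _ xW.
case: (lerP (Q (u 0)) (Q (u 1))) => c.
  exists S1 => //; apply: le_trans h1; apply: le_trans Qconv _.
  have : (1 - g x) * Q (u 0) <= (1 - g x) * Q (u 1) by rewrite ler_wpM2l // subr_ge0.
  lra.
exists S0 => //; apply: le_trans h0; apply: le_trans Qconv _.
have : g x * Q (u 1) <= g x * Q (u 0) by rewrite ler_wpM2l // ltW.
lra.
Qed.

End Rounding.

(** * Bounds for a fixed N *)

(** The hypothesis makes [W] admissible, so the minimum is attained and is not [+oo]. *)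
Lemma min_sizeP (R : realType) (k : nat) (G : zmodType) (W : {fset G}) (t : R) :
  t <= (T_set k W)%:R ->
  exists S : {fset G}, [/\ (S `<=` W)%fset, t <= (T_set k S)%:R,
    min_size k W t = (#|` S|%:R)%:E &
    forall S' : {fset G}, (S' `<=` W)%fset -> t <= (T_set k S')%:R ->
      (#|` S| <= #|` S'|)%N].
Proof.
move=> tW.
pose P n := `[< exists S : {fset G}, [/\ (S `<=` W)%fset, t <= (T_set k S)%:R
  & #|` S| = n] >].
have exP : exists n, P n by exists #|` W|; apply/asboolP; exists W; split.
have [_ /asboolP[S [SW tS <-]] Smin] := ex_minnP exP.
have {}Smin S' : (S' `<=` W)%fset -> t <= (T_set k S')%:R -> (#|` S| <= #|` S'|)%N.
  by move=> S'W tS'; apply: Smin; apply/asboolP; exists S'.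
exists S; split=> //; apply/le_anti/andP; split.
  by apply: (ge_bigmin_seq _ S) => //; rewrite fpowersetE.
rewrite /min_size big_seq_cond; elim/big_ind: _ => [|x y hx hy|S' /andP[]].
- by rewrite leey.
- by rewrite le_min hx hy.
- by rewrite fpowersetE => S'W tS'; rewrite lee_fin ler_nat Smin.
Qed.

(** With [q = p / (1 - b)] one has [q - p = q b <= 2 p b], and [rel_entropy_le_chi2] with
    [1 - p >= 1/2] gives the constant 8. *)
Lemma raised_weight (R : realType) (p b : R) : 0 < p <= 1/2 -> 0 < b <= 1/2 ->
  exists q, [/\ p <= q <= 1, q * (1 - b) = p & rel_entropy p q <= 8 * p * b ^+ 2].
Proof.
move=> /andP[p0 p1] /andP[b0 b1]; exists (p / (1 - b)); set q := p / _.
have c0 : 0 < 1 - b by lra.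
have qE : q * (1 - b) = p by rewrite /q divfK // gt_eqF.
have pq : p <= q by rewrite /q ler_pdivlMr // ler_piMr ?(ltW p0) //; lra.
have q1 : q <= 1 by rewrite ler_pdivrMr //; lra.
have q0 : 0 < q by exact: lt_le_trans pq.
split=> //; first by rewrite pq.
have p01 : 0 < p < 1 by rewrite p0; lra.
have q01 : 0 <= q <= 1 by rewrite ltW.
rewrite (le_trans (rel_entropy_le_chi2 p01 q01)) //.
rewrite ler_pdivrMr; last by rewrite mulr_gt0 //; lra.
have -> : q - p = q * b by move: qE; lra.
have q2 : q <= 2 * p.
  have : 0 <= p * (1 - 2 * b) by rewrite mulr_ge0 ?(ltW p0) //; lra.
  by rewrite ler_pdivrMr //; lra.
have h : (q * b) ^+ 2 <= (2 * p * b) ^+ 2.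
  rewrite ler_sqr ?nnegrE; first by rewrite ler_wpM2r // ltW.
    by rewrite mulr_ge0 // ltW.
  by rewrite !mulr_ge0 // ltW.
apply: (le_trans h).
have h2 : 0 <= p ^+ 2 * b ^+ 2 by rewrite mulr_ge0 ?sqr_ge0.
have h3 : 0 <= (p ^+ 2 * b ^+ 2) * (1 - 2 * p) by rewrite mulr_ge0 //; lra.
by move: h3; lra.
Qed.

(* [p] is raised slightly outside [S], in order to compensate for the
   progressions inside [S] that were already counted with weight [p ^+ k]. *)
Lemma phi_le (R : realType) (k : nat) (G : zmodType) (W S : {fset G}) (p delta : R) :
  (1 < k)%N -> 0 < p <= 1/2 -> 0 < delta * p ^+ k <= 1/2 -> (S `<=` W)%fset ->
  delta * p ^+ k * (T_set k W)%:R <= (T_set k S)%:R ->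
  (phi k W p delta <=
    (ln (1 / p) * #|` S|%:R + 8 * p * (delta * p ^+ k) ^+ 2 * #|` W|%:R)%:E)%E.
Proof.
move=> k1 p01 b01 SW tS.
have [q [/andP[pq q1] qE qI]] := raised_weight p01 b01.
have /andP[p0 _] := p01; have q0 : 0 < q by exact: lt_le_trans pq.
pose f x : R := if x \in S then 1 else q.
have f01 x : 0 <= f x <= 1 by rewrite /f; case: ifP => _; rewrite ?ler01 ?lexx ?(ltW q0).
apply: (@le_trans _ _ (\sum_(x <- W) rel_entropy p (f x))%:E).
  apply: ereal_inf_lbound; exists f => //; split=> //.
  (* A progression inside [S] has product [1 = q^k + (1 - q^k)]; any other has product at least
     [q^k]. *)
  apply: (@le_trans _ _ (\sum_(ab <- progressions k W)
    (q ^+ k + (1 - q ^+ k) * \prod_(i < k) (ab.1 + ab.2 *+ i \in S)%:R))).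
    rewrite big_split /= -mulr_sumr -/(T_fun k W (fun x => (x \in S)%:R)).
    rewrite T_fun_indicator //.
    have := @T_fun_const R k G W q; rewrite /T_fun => E.
    under eq_bigr do rewrite -[k in q ^+ k]card_ord -prodr_const.
    rewrite E {E}.
    have qk1 : 0 <= 1 - q ^+ k by rewrite subr_ge0 exprn_ile1 // ltW.
    have h1 := ler_wpM2l qk1 tS.
    apply: (le_trans _ (lerD (lexx _) h1)).
    (* One factor [q (1 - b)] equals [p] and the others are at least [p]. Hence
       [q^k T + (1 - q^k) b T >= (p^k + b) T], where [b = delta p^k]. *)
    have h2 : p ^+ k <= q ^+ k * (1 - delta * p ^+ k).
      rewrite -{1 2}(prednK (ltnW k1)) !exprSr -mulrA qE ler_pM2r //.
      by rewrite lerXn2r // nnegrE ltW.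
    have {h2} := ler_wpM2r (ler0n R (T_set k W)) h2.
    rewrite mulrDl mul1r mulrDl mulrA -lerBrDr => h2; apply: (le_trans h2).
    by rewrite le_eqVlt; apply/orP; left; apply/eqP; ring.
  apply: ler_sum => ab _; rewrite natr_forall.
  case: (boolP [forall i, _ \in S]) => [/forallP hS|_].
    by rewrite mulr1 addrC subrK big1 // => i _; rewrite /f hS.
  rewrite mulr0 addr0 -[k in q ^+ k]card_ord -prodr_const.
  by apply: ler_prod => i _; rewrite (ltW q0) /= /f; case: ifP.
rewrite lee_fin.
apply: (@le_trans _ _ (\sum_(x <- W) (ln (1 / p) * (x \in S)%:R
    + 8 * p * (delta * p ^+ k) ^+ 2))).
  apply: ler_sum => x _; rewrite /f; case: (x \in S); last by rewrite mulr0 add0r.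
  rewrite /rel_entropy subrr mul0r addr0 !mul1r mulr1n mulr1 lerDl.
  by rewrite mulr_ge0 ?sqr_ge0 // mulr_ge0 // ltW.
rewrite big_split /= -mulr_sumr sum_fset1 // big_const_seq count_predT iter_addr_0.
by rewrite [_ * #|` W|%:R]mulr_natr.
Qed.

(** * What the entropy of [f] controls *)

Section LowerBound.
Variables (R : realType) (k N : nat) (G : zmodType) (W : {fset G}) (p : R).
Hypotheses (p0 : 0 < p) (p1 : p < 1).
Variable F : ap_frame k N W.
Variable f : G -> R.
Hypothesis f01 : {in W, forall x, 0 <= f x <= 1}.
Local Notation Phi := (\sum_(x <- W) rel_entropy p (f x)).

Let p01 : 0 < p < 1. Proof. by rewrite p0. Qed.

Lemma entropy_sum_ge0 : 0 <= Phi.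
Proof. by rewrite big_seq; apply: sumr_ge0 => x xW; rewrite rel_entropy_ge0 ?f01. Qed.

Lemma sum_excess_le (s : R) : 0 <= s <= 1/4 ->
  s * (\sum_(x <- W) excess p (f x)) <= Phi + p * s ^+ 2 * N%:R.
Proof.
move=> s14; have /andP[s0 _] := s14.
have -> : p * s ^+ 2 * N%:R = \sum_(x <- W) p * s ^+ 2.
  by rewrite big_const_seq count_predT iter_addr_0 -[in LHS](card_frame F) mulr_natr.
rewrite mulr_sumr -big_split /= big_seq [leRHS]big_seq; apply: ler_sum => x xW.
have h1 := rel_entropy_ge_linear p01 (f01 xW) s14.
have h2 := rel_entropy_ge0 p01 (f01 xW).
have h3 : 0 <= p * s ^+ 2 by rewrite mulr_ge0 ?sqr_ge0 // ltW.
by rewrite /excess; case: (lerP 0 (f x - p)) => _; lra.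
Qed.

(** Slope [s = 1/4]: for [x > 2 p], [(x - p) / 4 - p / 16 >= x / 8 - x / 32 = 3 x / 32], which is at
    least [x / 11]. *)
Lemma sum_above_le : \sum_(x <- W) above (2 * p) (f x) <= 11 * Phi.
Proof.
rewrite mulr_sumr big_seq [leRHS]big_seq; apply: ler_sum => x xW.
have q : 0 <= (1/4 : R) <= 1/4 by lra.
have h1 := rel_entropy_ge_linear p01 (f01 xW) q.
have h2 := rel_entropy_ge0 p01 (f01 xW).
by rewrite /above; case: (ltrP (2 * p) (f x)) => h; rewrite ?mul1r ?mul0r; lra.
Qed.

Lemma sum_above_ln_le (tau : R) : p <= tau ->
  (ln (tau / p) - 1) * (\sum_(x <- W) above tau (f x)) <= Phi.
Proof.
move=> ptau; have t0 : 0 < tau by exact: lt_le_trans ptau.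
rewrite mulr_sumr big_seq [leRHS]big_seq; apply: ler_sum => x xW.
have h2 := rel_entropy_ge0 p01 (f01 xW).
rewrite /above; case: (ltrP tau (f x)) => h; rewrite ?mul1r ?mul0r ?mulr0 //.
have x0 : 0 < f x by exact: lt_trans h.
apply: (le_trans _ (rel_entropy_ge_ln p01 (f01 xW))).
have : f x * ln (tau / p) <= f x * ln (f x / p).
  by rewrite ler_pM2l // ler_ln ?posrE ?divr_gt0 // ler_pM2r ?invr_gt0 // ltW.
by have := p0; lra.
Qed.

End LowerBound.

(** * From a fractional weight to an admissible set *)

Section Conclude.
Variables (R : realType) (k N : nat) (G : zmodType) (W : {fset G}).
Hypotheses (k3 : (3 <= k)%N).
Variable F : ap_frame k N W.

(** An interval of length about [2 k a] gains [l^2 / (2 k^2) >= 2 a^2]; rounding the length up to an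
    integer costs at most [1 <= k a]. *)
Lemma enlarge_sqr (S : {fset G}) (a : R) : (S `<=` W)%fset ->
  1 <= k%:R * a -> 3 * k%:R * a <= N%:R -> 4 * k%:R ^+ 4 * #|` S|%:R <= N%:R :> R ->
  exists S' : {fset G}, [/\ (S' `<=` W)%fset,
    #|` S'|%:R <= #|` S|%:R + 3 * k%:R * a &
    (T_set k S)%:R + a ^+ 2 <= (T_set k S')%:R].
Proof.
move=> SW a1 aN Ssmall; have k1 := ltnW k3.
have kR : 0 < k%:R :> R by rewrite ltr0n ltnW.
pose l := (Num.truncn (2 * k%:R * a)).+1.
have /andP[l1 l2] : (Num.truncn (2 * k%:R * a))%:R <= 2 * k%:R * a < l%:R.
  by apply: truncn_itv; lra.
have lle : l%:R <= 3 * k%:R * a by rewrite /l -natr1; lra.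
have lN : (0 < l <= N)%N by rewrite /= -(ler_nat R) (le_trans lle).
have [S' [S'W cS' TS']] := enlarge k1 F SW lN Ssmall.
exists S'; split=> //.
  by apply: le_trans (_ : (#|` S| + l)%:R <= _); rewrite ?ler_nat // natrD lerD2l.
apply: le_trans TS'; rewrite lerD2l ler_pdivlMr; last by rewrite mulr_gt0 // exprn_gt0.
have : (2 * k%:R * a) ^+ 2 <= l%:R ^+ 2 by rewrite ler_sqr ?nnegrE // ?ltW //; lra.
by have := sqr_ge0 (k%:R * a); rewrite !exprMn; lra.
Qed.

Lemma integral_of_fractional (h : G -> R) (e r : R) (M : nat) :
  0 < e <= 1/2 -> 0 < r -> {in W, forall x, 0 <= h x <= 1} ->
  let m := \sum_(x <- W) h x in
  (forall S : {fset G}, (S `<=` W)%fset -> r ^+ 2 <= (T_set k S)%:R -> (M <= #|` S|)%N) ->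
  (1 - e ^+ 2) * r ^+ 2 <= T_fun k W h ->
  m <= 6 * k%:R * r ->
  6 * k%:R ^+ 2 <= e ^+ 4 * r ->
  56 * k%:R ^+ 5 * r <= N%:R ->
  (1 - e) * M%:R <= m + 7 * k%:R * e * r.
Proof.
move=> /andP[e0 e1] r0 h01 m Mmin Th mle c1 c2; have k1 := ltnW k3.

have kR : 3 <= k%:R :> R by rewrite (ler_nat R 3).
have m0 : 0 <= m by rewrite /m big_seq; apply: sumr_ge0 => x /h01/andP[].
set K : R := k%:R in mle c1 c2 kR *.
have e4 : e ^+ 4 <= 1/2 * e ^+ 3 by rewrite exprS ler_wpM2r // exprn_ge0 // ltW.
have e2 : e ^+ 2 <= e by rewrite expr2 ler_piMr //; lra.
have e3 : e ^+ 3 <= e ^+ 2 by rewrite exprS ler_piMl ?exprn_ge0 //; lra.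
have K2 : 3 * K <= K ^+ 2 by rewrite expr2 ler_wpM2r //; lra.
have er1 : 12 * K ^+ 2 <= e ^+ 3 * r.
  have : e ^+ 4 * r <= 1/2 * e ^+ 3 * r by rewrite ler_wpM2r // ltW.
  lra.
have er2 : 12 * K ^+ 2 <= e ^+ 2 * r.
  have : e ^+ 3 * r <= e ^+ 2 * r by rewrite ler_wpM2r // ltW.
  lra.
have er3 : 12 * K ^+ 2 <= e * r.
  have : e ^+ 2 * r <= e * r by rewrite ler_wpM2r // ltW.
  lra.
(* This weight keeps the loss [lam * m] below [e^2 r^2], while [T_k(S) <= K s^2 = lam e^2 s^2]
   forces [s - m <= e s + e r]. *)
pose lam := K / e ^+ 2.
have lamE : lam * e ^+ 2 = K by rewrite /lam divfK // expf_neq0 // gt_eqF.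
have lam0 : 0 < lam by rewrite divr_gt0 ?exprn_gt0 //; lra.
have [S SW Sround] := rounding k1 (ltW lam0) h01.
rewrite -/m in Sround; set s : R := #|` S|%:R in Sround.
have s0 : 0 <= s by rewrite /s.
have lamm : lam * m <= e ^+ 2 * r ^+ 2.
  have he2 : 0 < e ^+ 2 by rewrite exprn_gt0.
  rewrite -(ler_pM2l he2) mulrA [_ * lam]mulrC lamE.
  apply: (@le_trans _ _ (K * (6 * K * r))); first by rewrite ler_wpM2l //; lra.
  have := ler_wpM2r (ltW r0) c1; lra.
have mr : m <= (e * r) ^+ 2.
  have := ler_wpM2r (ltW r0) er2; rewrite exprMn.
  have : 3 * K * r <= K ^+ 2 * r by rewrite ler_wpM2r // ltW.
  have : 0 <= K * r by rewrite mulr_ge0 ?(ltW r0) //; lra.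
  lra.
have TS : (T_set k S)%:R <= K * s ^+ 2 by exact: (T_set_le R k1 F SW).
have dev : (s - m) ^+ 2 <= (e * s + e * r) ^+ 2.
  have h1 : lam * (s - m) ^+ 2 <= K * s ^+ 2 + lam * m.
    have : 0 <= T_fun k W h.
      by apply: le_trans Th; rewrite mulr_ge0 ?sqr_ge0 //; lra.
    lra.
  have h2 : lam * (s - m) ^+ 2 <= lam * ((e * s) ^+ 2 + m).
    have -> : lam * ((e * s) ^+ 2 + m) = lam * e ^+ 2 * s ^+ 2 + lam * m by ring.
    by rewrite lamE.
  move: h2; rewrite ler_pM2l // => h2.
  have : 0 <= (e * s) * (e * r) by rewrite !mulr_ge0 // ltW.
  rewrite sqrrD; lra.
have sm : s - m <= e * s + e * r.
  have h0 : 0 <= e * s + e * r by rewrite addr_ge0 // mulr_ge0 // ltW.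
  case: (lerP (s - m) 0) => [sm|sm]; first exact: (le_trans sm).
  by move: dev; rewrite ler_sqr ?nnegrE // ltW.
have es : e * s <= 1/2 * s by rewrite ler_wpM2r.
have er : e * r <= 1/2 * r by rewrite ler_wpM2r // ltW.
have Kr : 3 * r <= K * r by rewrite ler_wpM2r // ltW.
have sle : s <= 14 * K * r by lra.
have K5 : 0 <= K ^+ 4 by rewrite exprn_ge0 //; lra.
have Ke : 3 * (e * r) <= K * (e * r) by rewrite ler_wpM2r // mulr_ge0 // ltW.
(* The deficit of [T_k(S)] below [r^2] is at most [2 e^2 r^2], half from [Th] and half from [lamm];
   an enlargement with [a = 2 e r] gains [4 e^2 r^2]. *)
have [||| S' [S'W cS' TS']] := @enlarge_sqr S (2 * e * r) SW.
- rewrite -/K; have := ler_wpM2r (ltW r0) kR; nra.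
- rewrite -/K; apply: le_trans c2.
  have : K * (e * r) <= K * (1/2 * r) by rewrite ler_wpM2l //; lra.
  have : 81 * (K * r) <= K ^+ 4 * (K * r).
    rewrite ler_wpM2r //; first by rewrite mulr_ge0 ?(ltW r0) //; lra.
    have -> : (81 : R) = 3 ^+ 4 by ring.
    by rewrite lerXn2r ?nnegrE //; lra.
  lra.
- rewrite -/K -/s; apply: le_trans c2.
  have := ler_wpM2l K5 sle; lra.
have MS' : M%:R <= #|` S'|%:R :> R.
  rewrite ler_nat; apply: Mmin => //; apply: le_trans TS'.
  have h1 : 0 <= lam * (s - m) ^+ 2 by rewrite mulr_ge0 ?sqr_ge0 // ltW.
  rewrite -/K; have := sqr_ge0 (e * r); move: lamm Th Sround h1; rewrite !exprMn.
  lra.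
have cM : M%:R <= s + 3 * K * (2 * e * r) by exact: le_trans cS'.
have := ler_wpM2l (ltW e0) (ler0n R M).
have : (1 - e) * M%:R <= (1 - e) * (s + 3 * K * (2 * e * r)) by rewrite ler_wpM2l //; lra.
have : 0 <= e * (3 * K * (2 * e * r)) by rewrite !mulr_ge0 ?(ltW e0) ?(ltW r0) //; lra.
lra.
Qed.

End Conclude.

Lemma T_set_sub (k : nat) (G : zmodType) (A B : {fset G}) : (1 < k)%N ->
  (A `<=` B)%fset -> (T_set k A <= T_set k B)%N.
Proof.
move=> k1 /fsubsetP AB; apply/fsubset_leq_card/fsubsetP => ab.
by rewrite !mem_progressions // => /forallP h; apply/forallP => i; apply: AB.
Qed.

Lemma T_set_frame_ge (R : realType) (k N : nat) (G : zmodType) (W : {fset G}) :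
  (1 < k)%N -> (0 < N)%N -> ap_frame k N W ->
  N%:R ^+ 2 <= k%:R ^+ 2 * (T_set k W)%:R :> R.
Proof.
move=> k1 N0 F; have h : (1 * N <= N)%N by rewrite mul1n.
apply: le_trans (T_block R k1 F N0 h) _.
by rewrite ler_wpM2l ?sqr_ge0 // ler_nat T_set_sub // block_sub.
Qed.

(** Here [r^2] is the target count, [e] the relative accuracy, [tau] the cut-off and [eta * delta]
    the slope in the linear entropy bound. The numerical hypotheses make each error at most a small
    multiple of [e^2 r^2]. *)
Lemma entropy_ge (R : realType) (k N : nat) (G : zmodType) (W S0 : {fset G})
    (p delta e eta tau r : R) (f : G -> R) :
  let L := ln (1 / p) in let K : R := k%:R in
  (3 <= k)%N -> (0 < N)%N -> ap_frame k N W ->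
  0 < p < 1 -> 0 < delta -> 0 < e <= 1/2 -> 0 < eta -> eta * delta <= 1/4 ->
  2 * p <= tau -> (1 - e) * L <= ln (tau / p) - 1 ->
  0 < r ->
  6 * K ^+ 2 <= e ^+ 4 * r -> 56 * K ^+ 5 * r <= N%:R ->
  2178 * K ^+ 5 * tau * L ^+ 2 <= e ^+ 2 ->
  (S0 `<=` W)%fset -> r ^+ 2 <= (T_set k S0)%:R ->
  (forall S : {fset G}, (S `<=` W)%fset -> r ^+ 2 <= (T_set k S)%:R ->
    (#|` S0| <= #|` S|)%N) ->
  {in W, forall x, 0 <= f x <= 1} ->
  r ^+ 2 = delta * p ^+ k * (T_set k W)%:R ->
  4 * 2 ^+ k * K ^+ 4 * eta <= e ^+ 2 ->
  12 * 2 ^+ k * K ^+ 3 * p ^+ k.-1 * N%:R * L <= e ^+ 2 * (eta * delta) * r ->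
  (1 + delta) * p ^+ k * (T_set k W)%:R <= T_fun k W f ->
  (1 - 9 * K ^+ 2 * e) * (L * #|` S0|%:R) <= \sum_(x <- W) rel_entropy p (f x).
Proof.
move=> L K k3 N0 F p01 d0 /andP[e0 e1] eta0 s14 ptau Ltau r0 c1 c2 c3.
move=> S0W rS0 S0min f01; have k1 := ltnW k3; have /andP[p0 p1] := p01.
have K3 : 3 <= K by rewrite (ler_nat R 3).
have L0 : 0 < L by rewrite ln_gt0 // ltr_pdivlMr // mul1r.
set Phi := \sum_(x <- W) _; set M : R := #|` S0|%:R.
have Phi0 : 0 <= Phi by exact: entropy_sum_ge0.
have M0 : 0 <= M by [].
(* If the entropy exceeds [L * M] the claim is immediate; from here on [Phi <= L * M] is
   available. *)
case: (lerP Phi (L * M)) => [PhiM|/ltW PhiM]; last first.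
  move=> _ _ _ _; apply: (le_trans _ PhiM); rewrite ler_piMl ?mulr_ge0 // ?(ltW L0) // gerBl.
  by rewrite !mulr_ge0 // ?exprn_ge0 // ltW.
have tau0 : 0 < tau by apply: lt_le_trans ptau; rewrite mulr_gt0.
have rM : r <= K * M.
  have h : r ^+ 2 <= (K * M) ^+ 2.
    apply: (le_trans rS0); apply: (le_trans (T_set_le R k1 F S0W)).
    by rewrite exprMn ler_wpM2r ?sqr_ge0 // expr2 ler_peMl //; lra.
  by move: h; rewrite ler_sqr ?nnegrE // ?(ltW r0) // mulr_ge0 //; lra.
have er4 : e ^+ 4 * r <= r by rewrite ler_piMl ?(ltW r0) // exprn_ile1 //; lra.
have Kr : 3 * r <= K * r by rewrite ler_wpM2r // ltW.
have K2 : 9 <= K ^+ 2 by have -> : (9 : R) = 3 ^+ 2; [ring|rewrite ler_sqr ?nnegrE //; lra].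
have K0 : 0 <= K by [].
have Kr0 : 0 <= K * r by rewrite mulr_ge0 // ltW.
(* Enlarging the empty set with [a = r] already produces an admissible set. *)
have M3 : M <= 3 * K * r.
  have [||| S1 [S1W cS1 TS1]] := @enlarge_sqr R k N G W k3 F fset0 r (fsub0set _).
  - by rewrite -/K; lra.
  - rewrite -/K; apply: le_trans c2.
    have h1 : K ^+ 2 <= K ^+ 4 by rewrite ler_eXn2l //; lra.
    have := ler_wpM2r Kr0 (le_trans K2 h1); lra.
  - by rewrite cardfs0 mulr0.
  move: cS1; rewrite cardfs0 add0r; apply: le_trans; rewrite ler_nat.
  by apply: S0min => //; apply: le_trans TS1; rewrite lerDr.
pose h x := above tau (f x).
have h01 : {in W, forall x, 0 <= h x <= 1}.
  move=> x /f01/andP[f0 f1]; rewrite /h above_ge0 //= /above.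
  by case: (tau < f x); rewrite ?mul1r ?mul0r.
set m := \sum_(x <- W) h x.
have m0 : 0 <= m by rewrite /m big_seq; apply: sumr_ge0 => x /h01/andP[].
have ptau' : p <= tau by apply: le_trans ptau; lra.
have Phim : (1 - e) * L * m <= Phi.
  exact: le_trans (ler_wpM2r m0 Ltau) (sum_above_ln_le p0 p1 f01 ptau').
have m6 : m <= 6 * K * r.
  have h1 : (1 - e) * m <= M by rewrite -(ler_pM2l L0) mulrCA mulrA; apply: le_trans PhiM.
  have h2 : e * m <= 1/2 * m by rewrite ler_wpM2r.
  by lra.
have PhiK : Phi <= 3 * K * L * r.
  have := ler_wpM2l (ltW L0) M3; lra.
set X := \sum_(x <- W) excess p (f x); set Y := \sum_(x <- W) above (2 * p) (f x).
have Y0 : 0 <= Y.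
  by rewrite /Y big_seq; apply: sumr_ge0 => x /f01/andP[f0 _]; rewrite above_ge0.
have hY : Y <= 11 * Phi by exact: sum_above_le.
set s := eta * delta in s14 *.
have s0 : 0 < s by rewrite mulr_gt0.
have hX : s * X <= Phi + p * s ^+ 2 * N%:R.
  by apply: (sum_excess_le p0 p1 F f01); rewrite (ltW s0).
(* [Y <= 11 Phi <= 33 K L r], and [2 * 33^2 = 2178] is the constant in [c3]. *)
have A2 : tau * (K ^+ 3 * Y ^+ 2) <= e ^+ 2 * r ^+ 2 / 2.
  have h1 : Y ^+ 2 <= (33 * K * L * r) ^+ 2.
    rewrite ler_sqr ?nnegrE //; first lra.
    by rewrite !mulr_ge0 //; lra.
  have h2 : tau * (K ^+ 3 * Y ^+ 2) <= tau * (K ^+ 3 * (33 * K * L * r) ^+ 2).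
    by rewrite ler_wpM2l ?(ltW tau0) // ler_wpM2l // exprn_ge0 //; lra.
  have := ler_wpM2r (sqr_ge0 r) c3; lra.
move=> rE c4 c5 Tf.
have Th : (1 - e ^+ 2) * r ^+ 2 <= T_fun k W h.
  (* After multiplication by [s], [hX] splits this into two terms: [c5] bounds the one with
     [3 K L r], and [c4] with [rE] the one with [p s^2 N]. *)
  have A1 : 2 * (2 * p) ^+ k.-1 * (K ^+ 2 * N%:R * X) <= e ^+ 2 * r ^+ 2 / 2.
    rewrite -(ler_pM2l s0).
    have T0 := ler0n R (T_set k W).
    have NT : N%:R ^+ 2 <= K ^+ 2 * (T_set k W)%:R by exact: T_set_frame_ge F.
    set T : R := (T_set k W)%:R in NT T0.
    have QE : 2 * (2 * p) ^+ k.-1 = 2 ^+ k * p ^+ k.-1.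
      by rewrite exprMn mulrA -exprS prednK // ltnW.
    have wE : p ^+ k = p ^+ k.-1 * p by rewrite -exprSr prednK // ltnW.
    rewrite QE; rewrite wE -/T in rE.
    have w0 : 0 <= p ^+ k.-1 by rewrite exprn_ge0 // ltW.
    have Q0 : 0 <= 2 ^+ k :> R by rewrite exprn_ge0.
    set w := p ^+ k.-1 in w0 rE c5 *; set Q := 2 ^+ k in Q0 c4 c5 *.
    set n : R := N%:R in NT c5 hX *.
    have n0 : 0 <= n by [].
    have KQ : 0 <= Q * w * (K ^+ 2 * n) by rewrite !mulr_ge0 // exprn_ge0 //; lra.
    have h1 : s * (Q * w * (K ^+ 2 * n * X)) <=
        Q * w * (K ^+ 2 * n) * (3 * K * L * r + p * s ^+ 2 * n).
      rewrite (_ : s * _ = Q * w * (K ^+ 2 * n) * (s * X)); last by ring.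
      by rewrite ler_wpM2l //; lra.
    apply: (le_trans h1).
    have h2 : Q * w * (K ^+ 2 * n) * (3 * K * L * r) <= s * (e ^+ 2 * r ^+ 2) / 4.
      have := ler_wpM2r (ltW r0) c5; lra.
    have h3 : Q * w * (K ^+ 2 * n) * (p * s ^+ 2 * n) <= s * (e ^+ 2 * r ^+ 2) / 4.
      have h4 : Q * w * K ^+ 2 * p * s ^+ 2 * n ^+ 2 <=
          Q * w * K ^+ 2 * p * s ^+ 2 * (K ^+ 2 * T).
        by rewrite ler_wpM2l // !mulr_ge0 ?sqr_ge0 // ltW.
      have h5 : Q * w * K ^+ 2 * p * s ^+ 2 * (K ^+ 2 * T) = s * (Q * K ^+ 4 * eta * r ^+ 2).
        by rewrite rE /s; ring.
      have h6 : s * (4 * Q * K ^+ 4 * eta * r ^+ 2) <= s * (e ^+ 2 * r ^+ 2).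
        by rewrite ler_wpM2l ?(ltW s0) // ler_wpM2r ?sqr_ge0.
      by move: h4; rewrite h5; lra.
    by lra.
  have split := T_fun_le_split k3 p0 ptau F f01.
  rewrite -/X -/Y -/h -/K in split.
  have E : (1 + delta) * p ^+ k * (T_set k W)%:R = p ^+ k * (T_set k W)%:R + r ^+ 2.
    by rewrite rE; ring.
  move: split Tf; rewrite E.
  move: A1 A2; set a1 := _ * (_ * X); set a2 := tau * _; set pT := p ^+ k * _.
  lra.
clear rE c4 c5 Tf.
have e01 : 0 < e <= 1/2 by rewrite e0.
have main := integral_of_fractional k3 F e01 r0 h01 S0min Th m6 c1 c2.
rewrite -/m -/M -/K in main.
(* The errors [7 K e r] and [e M] add up to at most [8 K^2 e M]; the factor [1 - e] in [Phim] brings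
   the loss to [9 K^2 e]. *)
have h1 : 7 * K * e * r <= 7 * K ^+ 2 * e * M.
  have : 0 <= K * e by rewrite mulr_ge0 ?(ltW e0) //; lra.
  by move=> /ler_wpM2l/(_ _ _ rM); lra.
have h2 : e * M <= K ^+ 2 * e * M.
  by rewrite ler_wpM2r // ler_peMl ?(ltW e0) //; lra.
have h3 : (1 - 8 * K ^+ 2 * e) * M <= m by lra.
have h4 : (1 - e) * L * ((1 - 8 * K ^+ 2 * e) * M) <= Phi.
  by apply: le_trans Phim; rewrite ler_wpM2l // mulr_ge0 ?(ltW L0) //; lra.
apply: (le_trans _ h4).
have h5 : L * (e * M) <= L * (K ^+ 2 * e * M) by rewrite ler_wpM2l // ltW.
have h6 : 0 <= e * L * (8 * K ^+ 2 * e) * M.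
  by rewrite !mulr_ge0 ?sqr_ge0 // ltW.
lra.
Qed.

(** * The groups Z and Z/NZ *)

(** [pt] is shifted by one since [[N]] starts at 1. As [Z] has no torsion, a fibre has at most one
    element. *)
Lemma int_frame (k N : nat) : (1 < k)%N -> ap_frame k N (Omega IntegerInterval N).
Proof.
move=> k1; apply: (@APFrame k N int (Omega IntegerInterval N) (fun n => Posz n.+1) Posz).
- by move=> a b i; rewrite -mulr_natr natz -PoszM -PoszD addSn.
- by move=> a b _ _ [].
- by move=> a b _ _ [].
- by move=> n nN; apply/imfsetP; exists n.+1; rewrite //= mem_iota add1n ltnS.
- have u : uniq (map Posz (iota 1 N)) by rewrite map_inj_uniq ?iota_uniq // => ? ? [].
  have /perm_size -> : perm_eq (Omega IntegerInterval N) (map Posz (iota 1 N)).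
    apply: (uniq_perm (fset_uniq _) u) => x.
    by apply/imfsetP/mapP => -[n /= ? ->]; exists n.
  by rewrite size_map size_iota.
- move=> B d y /andP[d0 dk] Bd; case: (fset_0Vmem B) => [->|[x xB]].
    by rewrite cardfs0.
  apply: leq_trans (ltnW k1); rewrite -(cardfs1 x); apply: fsubset_leq_card.
  apply/fsubsetP => z zB; rewrite inE; have := Bd _ zB; rewrite -(Bd _ xB).
  by move=> /eqP; rewrite -subr_eq0 -mulrnBl mulrn_eq0 subr_eq0 gtn_eqF.
Qed.

Lemma cyclic_frame (k N : nat) : (0 < N)%N -> ap_frame k N (Omega CyclicGroup N).
Proof.
move=> N0; have NE := prednK N0.
apply: (@APFrame k N 'I_N.-1.+1 (Omega CyclicGroup N) inZp inZp).
- move=> a b i; rewrite Zp_mulrn; apply/val_inj => /=.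
  by rewrite modnMml modnDm.
- move=> a b; rewrite !inE => aN bN /(congr1 val) /=.
  by rewrite NE !modn_small.
- move=> a b; rewrite !inE => aN bN /(congr1 val) /=.
  by rewrite NE !modn_small.
- by move=> n _; rewrite /= !inE.
- by rewrite /Omega /= card_finset card_ord.
- move=> B d y /andP[d0 dk] Bd.
  (* Solutions of [b *+ d = y] share the remainder of [b d] modulo [N], so the quotient determines
     [b], and it takes fewer than [d + 1] values. *)
  pose g (b : 'I_N.-1.+1) := ((b * d) %/ N)%N.
  have vE (b : 'I_N.-1.+1) : val (b *+ d) = ((b * d) %% N)%N.
    by rewrite Zp_mulrn /=; congr modn.
  have gi : {in B &, injective g}.
    move=> b b' /Bd/(congr1 val) h /Bd/(congr1 val) h' gg.
    apply/val_inj/eqP; rewrite -(eqn_pmul2r d0) (divn_eq (b * d) N).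
    rewrite [X in _ == X](divn_eq (b' * d) N).
    by move: gg h h'; rewrite /g !vE => -> -> ->.
  have <- : #|` (g @` B)%fset| = #|` B| by rewrite card_in_imfset.
  apply: (@leq_trans d); last exact: ltnW.
  rewrite -[d in leqRHS](size_iota 0); apply: uniq_leq_size (fset_uniq _) _ => q.
  move=> /imfsetP[b _ ->]; rewrite mem_iota add0n /= /g ltn_divLR //.
  by rewrite mulnC ltn_pmul2l // (leq_trans (ltn_ord b)) // NE.
Qed.

Lemma frame (c : setting) (k N : nat) : (1 < k)%N -> (0 < N)%N ->
  ap_frame k N (Omega c N).
Proof. by case: c => k1 N0; [exact: int_frame|exact: cyclic_frame]. Qed.

(** * Asymptotics *)

Lemma expR_mul_ln_inv (R : realType) (p : R) : 0 < p -> p * expR (ln (1 / p)) = 1.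
Proof. by move=> p0; rewrite lnK ?posrE ?divr_gt0 // mul1r divff // gt_eqF. Qed.

Lemma le_half_of_ln (R : realType) (p : R) : 0 < p -> 1 <= ln (1 / p) -> p <= 1/2.
Proof.
move=> p0 L1; have := expR_ge1Dx (ln (1 / p)) => h.
have := ler_wpM2l (ltW p0) h; rewrite expR_mul_ln_inv //.
have := ler_wpM2l (ltW p0) L1; lra.
Qed.

(** For [tau = L^-3]: [e^L >= L^4 / 24] and [L >= 48] give [p L^3 <= 1/2], while [ln L <= e L / 6]
    makes [3 ln L + 1] at most [e L]. *)
Lemma threshold (R : realType) (p e : R) : let L := ln (1 / p) in
  0 < p -> 0 < e -> 48 <= L -> 72 / e ^+ 2 <= L -> 2 / e <= L ->
  2 * p <= (L ^+ 3)^-1 /\ (1 - e) * L <= ln ((L ^+ 3)^-1 / p) - 1.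
Proof.
move=> L p0 e0 L48 Le2 Le; have L0 : 0 < L by lra.
have pE := expR_mul_ln_inv p0; rewrite -/L in pE.
have L3 : 0 < L ^+ 3 by rewrite exprn_gt0.
split.
  rewrite -[leRHS]mul1r ler_pdivlMr //.
  have h : 1 + L ^+ 4 / 24 <= expR L by exact: (expR_ge1Dxn 3 (ltW L0)).
  have h1 := ler_wpM2l (ltW p0) h; rewrite pE in h1.
  have h2 : (p * L ^+ 3) * 48 <= (p * L ^+ 3) * L.
    by rewrite ler_wpM2l // mulr_ge0 // ltW.
  have h3 : (p * L ^+ 3) * L = p * L ^+ 4 by ring.
  by rewrite h3 in h2; lra.
have x0 : 0 <= e * L / 6 by rewrite divr_ge0 // mulr_ge0 // ltW.
have h : 1 + (e * L / 6) ^+ 2 / 2 <= expR (e * L / 6) by exact: (expR_ge1Dxn 1 x0).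
have h2 : L <= expR (e * L / 6).
  apply: (le_trans _ h).
  have e2 : 0 < e ^+ 2 by rewrite exprn_gt0.
  rewrite ler_pdivrMr // in Le2; have := ler_wpM2l (ltW L0) Le2; lra.
have h3 : ln L <= e * L / 6 by rewrite -[leRHS]expRK ler_ln ?posrE // expR_gt0.
rewrite ler_pdivrMr // in Le.
rewrite ln_div ?posrE ?invr_gt0 // lnV ?posrE // lnXn //.
have -> : ln p = - L by rewrite /L mul1r lnV ?posrE // opprK.
by rewrite mulrS mulr2n; lra.
Qed.

(** Meant for [w = p^(k-1)], [q = p^k], [v = p^(k-2)], [n = N]. Squaring and using
    [r^2 >= d q n^2 / K^2] reduces the claim to smallness of [d^-3 v L^2]: the origin of the
    condition on [delta^-3 p^(k-2) log(1/p)^2]. *)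
Lemma linear_term_small (R : realType) (A K w v q n L e eta d r : R) :
  0 <= A -> 0 < K -> 0 <= w -> 0 <= n -> 0 <= L -> 0 <= eta -> 0 < d -> 0 <= r ->
  0 <= q -> w ^+ 2 = q * v -> d * q * n ^+ 2 <= K ^+ 2 * r ^+ 2 ->
  144 * A ^+ 2 * K ^+ 8 * (d ^- 3 * v * L ^+ 2) <= e ^+ 4 * eta ^+ 2 ->
  12 * A * K ^+ 3 * w * n * L <= e ^+ 2 * (eta * d) * r.
Proof.
move=> A0 K0 w0 n0 L0 eta0 d0 r0 q0 wE qn small.
have K3 : 0 <= K ^+ 3 by rewrite exprn_ge0 // ltW.
have l0 : 0 <= 12 * A * K ^+ 3 * w * n * L.
  by do 5 (apply: mulr_ge0 => //).
have r1 : 0 <= e ^+ 2 * (eta * d) * r.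
  by apply: mulr_ge0 => //; apply: mulr_ge0; rewrite ?sqr_ge0 // mulr_ge0 // ltW.
rewrite -ler_sqr ?nnegrE //.
have K2 : 0 < K ^+ 2 by rewrite exprn_gt0.
rewrite -(ler_pM2r K2).
have d3 : 0 < d ^+ 3 by rewrite exprn_gt0.
have h1 : 144 * A ^+ 2 * K ^+ 8 * (v * L ^+ 2) <= e ^+ 4 * eta ^+ 2 * d ^+ 3.
  rewrite -ler_pdivrMr // (le_trans _ small) // le_eqVlt; apply/orP; left.
  by apply/eqP; field; rewrite gt_eqF.
have h2 := ler_wpM2l (mulr_ge0 q0 (sqr_ge0 n)) h1.
have h3 : 0 <= e ^+ 4 * eta ^+ 2 * d ^+ 2.
  by apply: mulr_ge0; rewrite ?sqr_ge0 // mulr_ge0 ?sqr_ge0 // exprn_even_ge0.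
have h4 := ler_wpM2l h3 qn.
rewrite (_ : _ ^+ 2 * K ^+ 2 =
    144 * A ^+ 2 * K ^+ 8 * (w ^+ 2 * (n ^+ 2 * L ^+ 2))); last by ring.
by rewrite wE; lra.
Qed.

Lemma sqr_expr_pred (R : pzSemiRingType) (x : R) (k : nat) : (1 < k)%N ->
  (x ^+ k.-1) ^+ 2 = x ^+ k * x ^+ (k - 2).
Proof.
case: k => [|[|k]] // _; rewrite subSS subSS subn0 -exprM -exprD.
by congr (_ ^+ _); lia.
Qed.

(** [e] turns the loss [9 K^2 e] of [entropy_ge] into [eps]. The factor [D + 1] in [eta] keeps the
    slope [eta * d] at most [e^2 <= 1/4]. *)
Lemma phi_bounds (R : realType) (k N : nat) (G : zmodType) (W : {fset G})
    (p d D eps : R) :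
  let K : R := k%:R in let e := eps / (9 * K ^+ 2) in
  let eta := e ^+ 2 / (4 * 2 ^+ k * K ^+ 4 * (D + 1)) in let L := ln (1 / p) in
  (3 <= k)%N -> (0 < N)%N -> ap_frame k N W ->
  0 < p < 1 -> 0 < d <= D -> 0 < eps <= 1 ->
  48 <= L -> 72 / e ^+ 2 <= L -> 2 / e <= L -> 2178 * K ^+ 5 / e ^+ 2 <= L ->
  8 * K ^+ 2 / eps <= L ->
  d * p ^+ k <= 1/2 -> K * (56 * K ^+ 5) ^+ 2 * (d * p ^+ k) <= 1 ->
  K ^+ 2 * (6 * K ^+ 2 / e ^+ 4) ^+ 2 <= d * p ^+ k * N%:R ^+ 2 ->
  144 * (2 ^+ k) ^+ 2 * K ^+ 8 * (d ^- 3 * p ^+ (k - 2) * L ^+ 2) <= e ^+ 4 * eta ^+ 2 ->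
  exists S0 : {fset G}, [/\ (0 < #|` S0|)%N,
    min_size k W (d * p ^+ k * (T_set k W)%:R) = (#|` S0|%:R)%:E,
    (((1 - eps) * (L * #|` S0|%:R))%:E <= phi k W p d)%E &
    (phi k W p d <= ((1 + eps) * (L * #|` S0|%:R))%:E)%E].
Proof.
move=> K e eta L k3 N0 F p01 dD eps01 L48 Le2 Le LK Leps.
have k1 := ltnW k3.
have K3 : 3 <= K by rewrite (ler_nat R 3).
have /andP[p0 p1] := p01; have /andP[d0 dleD] := dD; have /andP[eps0 eps1] := eps01.
have L0 : 0 < L by lra.
have K2 : 9 <= K ^+ 2 by have -> : (9 : R) = 3 ^+ 2; [ring|rewrite ler_sqr ?nnegrE //; lra].
have e0 : 0 < e by rewrite divr_gt0 //; lra.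
have eE : 9 * K ^+ 2 * e = eps by rewrite /e mulrCA divff ?mulr1 // gt_eqF //; lra.
have e1 : e <= 1/2 by rewrite ler_pdivrMr; lra.
have p2 : p <= 1/2 by apply: le_half_of_ln => //; rewrite -/L; lra.
have T0 := ler0n R (T_set k W).
have NT : N%:R ^+ 2 <= K ^+ 2 * (T_set k W)%:R by exact: T_set_frame_ge F.
have TN : (T_set k W)%:R <= K * N%:R ^+ 2.
  by have := T_set_le R k1 F (fsubset_refl W); rewrite (card_frame F).
have n0 : 0 < N%:R :> R by rewrite ltr0n.
have b0 : 0 < d * p ^+ k by rewrite mulr_gt0 // exprn_gt0.
move=> b1 b2 b3 small.
have hyps : 0 < d * p ^+ k <= 1/2 by rewrite b0.
have Q0 : 0 < 2 ^+ k :> R by rewrite exprn_gt0.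
have D1 : 0 < D + 1 by apply: ltr_wpDl => //; exact: le_trans (ltW d0) dleD.
have K4 : 0 < K ^+ 4 by rewrite exprn_gt0 //; lra.
have den0 : 0 < 4 * 2 ^+ k * K ^+ 4 * (D + 1).
  by apply: mulr_gt0 => //; apply: mulr_gt0 => //; apply: mulr_gt0.
have eta0 : 0 < eta by rewrite divr_gt0 // exprn_gt0.
have etaE : 4 * 2 ^+ k * K ^+ 4 * eta * (D + 1) = e ^+ 2.
  by rewrite mulrAC mulrC /eta divfK // gt_eqF.
have c4 : 4 * 2 ^+ k * K ^+ 4 * eta <= e ^+ 2.
  rewrite -etaE ler_peMr //; last by rewrite lerDr (le_trans (ltW d0)).
  by apply: mulr_ge0 (ltW eta0); apply: mulr_ge0 (ltW K4); apply: mulr_ge0 (ltW Q0).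
pose b := d * p ^+ k; pose t := b * (T_set k W)%:R; pose r := Num.sqrt t.
have bn : d * p ^+ k * N%:R ^+ 2 <= K ^+ 2 * t.
  have -> : K ^+ 2 * t = d * p ^+ k * (K ^+ 2 * (T_set k W)%:R) by rewrite /t /b; ring.
  by rewrite ler_wpM2l // ltW.
have t0 : 0 < t.
  rewrite -(@pmulr_rgt0 _ (K ^+ 2)); last by rewrite (lt_le_trans _ K2).
  by apply: lt_le_trans bn; rewrite mulr_gt0 // exprn_gt0.
have r0 : 0 < r by rewrite sqrtr_gt0.
have rE : r ^+ 2 = t by rewrite sqr_sqrtr // ltW.
have c5 : 12 * 2 ^+ k * K ^+ 3 * p ^+ k.-1 * N%:R * L <= e ^+ 2 * (eta * d) * r.
  have w : (p ^+ k.-1) ^+ 2 = p ^+ k * p ^+ (k - 2).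
    exact: sqr_expr_pred.
  have w0 : 0 <= p ^+ k.-1 by rewrite exprn_ge0 // ltW.
  have q0 : 0 <= p ^+ k by rewrite exprn_ge0 // ltW.
  have K0 : 0 < K by rewrite (lt_le_trans _ K3).
  rewrite -rE in bn.
  exact: (linear_term_small (ltW Q0) K0 w0 (ltW n0) (ltW L0) (ltW eta0) d0 (ltW r0)
    q0 w bn small).
have c4' : 4 * e ^+ 2 <= 1 by have : e * e <= e * (1/2) by [rewrite ler_pM2l]; lra.
have c44 : 1 <= 4 * 2 ^+ k * K ^+ 4.
  have Q1 : 1 <= 2 ^+ k :> R by rewrite exprn_ege1 // ler1n.
  have K1 : 1 <= K ^+ 4 by rewrite exprn_ege1 // (le_trans _ K3) // ler1n.
  by apply: mulr_ege1 => //; apply: mulr_ege1 => //; rewrite ler1n.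
have etad : eta * d <= 1/4.
  have h1 : eta * d <= eta * (D + 1).
    by rewrite ler_pM2l // (le_trans dleD) // lerDl.
  have h2 : eta * (D + 1) <= e ^+ 2.
    by rewrite -etaE -[_ * eta * _]mulrA ler_peMl // mulr_ge0 // ltW.
  by apply: (le_trans h1); apply: (le_trans h2); lra.
have tW : t <= (T_set k W)%:R by rewrite /t ler_piMl // (le_trans b1) //; lra.
have [S0 [S0W tS0 minE S0min]] := min_sizeP tW.
rewrite -/b -/t in b0 b1 b2 b3 bn *.
have S0gt : (0 < #|` S0|)%N.
  rewrite lt0n; apply/eqP => S00; have := T_set_le R k1 F S0W.
  by rewrite S00 expr0n mulr0 leNgt (lt_le_trans t0 tS0).
exists S0; rewrite minE; split=> //.
- apply: le_ereal_inf_tmp => _ [f [f01 Tf] <-]; rewrite lee_fin -eE.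
  have [ptau Ltau] := threshold p0 e0 L48 Le2 Le.
  apply: (@entropy_ge R k N G W S0 p d e eta (L ^+ 3)^-1 r f) => //.
  + by rewrite e0.
  + move: b3; rewrite -/K => b3.
    have e4 : 0 < e ^+ 4 by rewrite exprn_gt0.
    have Kp : 0 < K ^+ 2 by rewrite (lt_le_trans _ K2).
    have q0 : 0 <= 6 * K ^+ 2 / e ^+ 4.
      by rewrite divr_ge0 ?(ltW e4) // mulr_ge0 // sqr_ge0.
    have : (6 * K ^+ 2 / e ^+ 4) ^+ 2 <= r ^+ 2.
      by rewrite -(ler_pM2l Kp) rE; exact: le_trans b3 bn.
    by rewrite ler_sqr ?nnegrE ?(ltW r0) // ler_pdivrMr // [r * _]mulrC.
  + rewrite -/K -ler_sqr ?nnegrE //; last first.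
      by rewrite !mulr_ge0 // ?exprn_ge0 ?(ltW r0) //; lra.
    rewrite exprMn rE.
    have h0 := ler_wpM2l (ltW b0) TN; rewrite -/t in h0.
    have h1 := ler_wpM2l (sqr_ge0 (56 * K ^+ 5)) h0.
    apply: (le_trans h1).
    have := ler_wpM2r (sqr_ge0 (N%:R : R)) b2; lra.
  + have L3 : 0 < L ^+ 3 by rewrite exprn_gt0.
    rewrite ler_pdivrMr ?exprn_gt0 // in LK.
    rewrite -/K -/L mulrAC ler_pdivrMr //.
    have := ler_wpM2r (sqr_ge0 L) LK; lra.
  + by rewrite rE.
  + by move=> S SW; rewrite rE; apply: S0min.
- have p12 : 0 < p <= 1/2 by rewrite p0.
  have := phi_le k1 p12 hyps S0W tS0; rewrite -/L -/b (card_frame F) => h.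
  apply: (le_trans h); rewrite lee_fin.
  set M : R := #|` S0|%:R.
  have M0 : 0 <= M by [].
  have TM : t <= K * M ^+ 2 by apply: (le_trans tS0); exact: (T_set_le R k1 F S0W).
  (* [(b N)^2 <= b N^2 <= K^2 t <= K^3 M^2]. The entropy spent outside [S0] is thus at most
     [8 K^2 M <= eps L M]. *)
  have bN : b * N%:R <= K ^+ 2 * M.
    rewrite -ler_sqr ?nnegrE; last 2 first.
    + by rewrite mulr_ge0 // ltW.
    + by rewrite mulr_ge0 // sqr_ge0.
    have h1 : (b * N%:R) ^+ 2 <= b * N%:R ^+ 2.
      by rewrite exprMn ler_wpM2r ?sqr_ge0 // expr2 ler_piMr ?(ltW b0) //; lra.
    apply: (le_trans h1); apply: (le_trans bn).
    apply: (@le_trans _ _ (K ^+ 2 * (K * M ^+ 2))).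
      by rewrite ler_wpM2l ?sqr_ge0.
    have h2 : K ^+ 3 * M ^+ 2 <= K ^+ 4 * M ^+ 2.
      by rewrite ler_wpM2r ?sqr_ge0 // ler_eXn2l //; lra.
    lra.
  have h1 : 8 * p * b ^+ 2 * N%:R <= 8 * K ^+ 2 * M.
    have h2 : (p * b) * (b * N%:R) <= 1 * (K ^+ 2 * M).
      have pb1 : p * b <= 1 by apply: mulr_ile1; rewrite ?(ltW p0) ?(ltW b0) //; lra.
      by apply: ler_pM; rewrite // mulr_ge0 // ltW.
    lra.
  rewrite ler_pdivrMr // in Leps.
  have := ler_wpM2r M0 Leps; lra.
Qed.

(** * Validity of the bounds for large [N] *)

Lemma near_ln_inv_ge (R : realType) (p : nat -> R) (B : R) :
  (forall N, (0 < N)%N -> 0 < p N) -> p N @[N --> \oo] --> 0 ->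
  \forall N \near \oo, B <= ln (1 / p N).
Proof.
move=> p_gt0 p0.
near=> N.
have pN : 0 < p N by apply: p_gt0; near: N; exact: nbhs_infty_gt.
have h : p N < expR (- B).
  rewrite -(gtr0_norm pN); near: N.
  by apply: (cvgr0_norm_lt _ p0); rewrite expR_gt0.
rewrite mul1r lnV ?posrE // -[B]opprK lerN2 -[leRHS]expRK.
by rewrite ler_ln ?posrE ?expR_gt0 // ltW.
Unshelve. all: by end_near.
Qed.

Lemma near_phi_bounds (R : realType) (k : nat) (c : setting)
    (p delta : nat -> R) (eps : R)
    (hk : (3 <= k)%N)
    (hp : forall N, (0 < N)%N -> 0 < p N < 1)
    (hdelta : forall N, (0 < N)%N -> 0 < delta N)
    (hp0 : p N @[N --> \oo] --> 0)
    (hdelta1 : delta =O_\oo (fun _ : nat => 1 : R))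
    (hlarge : delta N * p N ^+ k * N%:R ^+ 2 @[N --> \oo] --> +oo)
    (hsmall : delta N ^- 3 * p N ^+ (k - 2) * ln (1 / p N) ^+ 2
                @[N --> \oo] --> 0) :
  0 < eps <= 1 ->
  \forall N \near \oo, exists S0 : {fset ambient c N},
   [/\ (0 < #|` S0|)%N, 0 < ln (1 / p N),
    min_size k (Omega c N) (delta N * p N ^+ k * (T_set k (Omega c N))%:R)
      = (#|` S0|%:R)%:E,
    (((1 - eps) * (ln (1 / p N) * #|` S0|%:R))%:E <=
      phi k (Omega c N) (p N) (delta N))%E &
    (phi k (Omega c N) (p N) (delta N) <=
      ((1 + eps) * (ln (1 / p N) * #|` S0|%:R))%:E)%E].
Proof.
move=> eps01; have k1 := ltnW hk; have /andP[eps0 _] := eps01.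
have /eqO_exP[D D0 hD] := hdelta1.
have p_gt0 N : (0 < N)%N -> 0 < p N by case/hp/andP.
pose K : R := k%:R.
have K0 : 0 < K by rewrite ltr0n ltnW // ltnW.
pose e := eps / (9 * K ^+ 2).
have e0 : 0 < e by rewrite divr_gt0 // mulr_gt0 // exprn_gt0.
pose eta := e ^+ 2 / (4 * 2 ^+ k * K ^+ 4 * (D + 1)).
have eta0 : 0 < eta.
  rewrite divr_gt0 ?exprn_gt0 //; apply: mulr_gt0; last by rewrite addr_gt0.
  by apply: mulr_gt0; rewrite ?exprn_gt0 // mulr_gt0 // exprn_gt0.
pose B := K * (56 * K ^+ 5) ^+ 2.
have B0 : 0 < B by rewrite mulr_gt0 // exprn_gt0 // mulr_gt0 // exprn_gt0.
pose C := 144 * (2 ^+ k) ^+ 2 * K ^+ 8.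
have C0 : 0 < C.
  by apply: mulr_gt0; [apply: mulr_gt0 => //|]; rewrite !exprn_gt0.
have ge (m : R) := near_ln_inv_ge m p_gt0 hp0.
have plt (a : R) : 0 < a -> \forall N \near \oo, p N < a.
  move=> a0; near=> N; apply: le_lt_trans (ler_norm _) _; near: N.
  exact: (cvgr0_norm_lt _ hp0).
pose s := e ^+ 4 * eta ^+ 2 / C.
have s0 : 0 < s by apply: divr_gt0 => //; apply: mulr_gt0; rewrite exprn_gt0.
have hsmall' := cvgr0_norm_le _ hsmall s s0.
have hlarge' : \forall N \near \oo,
    K ^+ 2 * (6 * K ^+ 2 / e ^+ 4) ^+ 2 <= delta N * p N ^+ k * N%:R ^+ 2.
  by move/cvgryPge: hlarge; exact.
near=> N.
have N0 : (0 < N)%N by near: N; exact: nbhs_infty_gt.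
have pN := hp _ N0; have /andP[pN0 pN1] := pN; have dN0 := hdelta _ N0.
have dD : delta N <= D.
  have : `|delta N| <= D * `|1 : R| by near: N; exact: hD.
  by rewrite normr1 mulr1 gtr0_norm.
have pk : p N ^+ k <= p N by rewrite -[leRHS]expr1 ler_wiXn2l ?(ltW pN0) ?(ltW pN1) // (ltnW k1).
(* [delta p^k <= D p], so only [p -> 0] is used here. *)
have dpk (a : R) : p N < a / D -> delta N * p N ^+ k <= a.
  rewrite ltr_pdivlMr // mulrC => h; apply: le_trans (ltW h).
  by apply: ler_pM; rewrite // ?exprn_ge0 // ltW.
have L48 : 48 <= ln (1 / p N) by near: N; exact: ge.
have Le2 : 72 / e ^+ 2 <= ln (1 / p N) by near: N; exact: ge.
have Le : 2 / e <= ln (1 / p N) by near: N; exact: ge.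
have LK : 2178 * K ^+ 5 / e ^+ 2 <= ln (1 / p N) by near: N; exact: ge.
have Leps : 8 * K ^+ 2 / eps <= ln (1 / p N) by near: N; exact: ge.
have b1 : delta N * p N ^+ k <= 1 / 2.
  by apply: dpk; near: N; apply: plt; rewrite !divr_gt0.
have b2 : B * (delta N * p N ^+ k) <= 1.
  rewrite mulrC -ler_pdivlMr //.
  by apply: dpk; near: N; apply: plt; rewrite !divr_gt0.
have b3 : K ^+ 2 * (6 * K ^+ 2 / e ^+ 4) ^+ 2 <= delta N * p N ^+ k * N%:R ^+ 2.
  by near: N; exact: hlarge'.
have small : C * (delta N ^- 3 * p N ^+ (k - 2) * ln (1 / p N) ^+ 2) <= e ^+ 4 * eta ^+ 2.
  rewrite mulrC -ler_pdivlMr // (le_trans (ler_norm _)) //.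
  by near: N; exact: hsmall'.
have dD' : 0 < delta N <= D by rewrite dN0.
have [S0 [S0gt minE lo up]] :=
  phi_bounds hk N0 (frame c k1 N0) pN dD' eps01 L48 Le2 Le LK Leps b1 b2 b3 small.
exists S0; split=> //.
exact: lt_le_trans L48.
Unshelve. all: by end_near.
Qed.

Theorem proposition2p3 (R : realType) (k : nat) (c : setting)
    (p delta : nat -> R)
    (hk : (3 <= k)%N)
    (hp : forall N, (0 < N)%N -> 0 < p N < 1)
    (hdelta : forall N, (0 < N)%N -> 0 < delta N)
    (hp0 : p N @[N --> \oo] --> 0)
    (hdelta1 : delta =O_\oo (fun _ : nat => 1 : R))
    (hlarge : delta N * p N ^+ k * N%:R ^+ 2 @[N --> \oo] --> +oo)
    (hsmall : delta N ^- 3 * p N ^+ (k - 2) * ln (1 / p N) ^+ 2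
                @[N --> \oo] --> 0) :
  exists2 eps : nat -> R,
    eps N @[N --> \oo] --> 0 &
    \forall N \near \oo,
      phi k (Omega c N) (p N) (delta N) =
      (((1 + eps N) * ln (1 / p N))%:E *
       min_size k (Omega c N)
         (delta N * p N ^+ k * (T_set k (Omega c N))%:R))%E.
Proof.
have near_bounds eps := near_phi_bounds c hk hp hdelta hp0 hdelta1 hlarge hsmall (eps := eps).
pose m N := fine (min_size k (Omega c N) (delta N * p N ^+ k * (T_set k (Omega c N))%:R)).
(* The relative error itself. [fine] sends infinities to 0 and division by 0 gives 0, but eventually
   [phi] is finite and the denominator positive. *)
exists (fun N => fine (phi k (Omega c N) (p N) (delta N)) / (ln (1 / p N) * m N) - 1).
  apply/cvgr0Pnorm_le => eps eps0.
  have eps01 : 0 < Num.min eps 1 <= 1 by rewrite lt_min eps0 ltr01 ge_min lexx orbT.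
  apply: filterS (near_bounds _ eps01) => N [S0 [S0gt L0 minE lo up]].
  have M0 : 0 < ln (1 / p N) * m N by rewrite /m minE mulr_gt0 // ltr0n.
  have phiE : phi k (Omega c N) (p N) (delta N)
      = (fine (phi k (Omega c N) (p N) (delta N)))%:E.
    rewrite fineK // fin_numElt (lt_le_trans _ lo) ?ltNyr //=.
    by rewrite (le_lt_trans up) // ltry.
  move: lo up; rewrite phiE !lee_fin /= => lo up.
  have mE : m N = #|` S0|%:R by rewrite /m minE.
  rewrite -mE in lo up; apply: (@le_trans _ _ (Num.min eps 1)); last by rewrite ge_min lexx.
  rewrite ler_norml lerBrDr lerBlDr ler_pdivlMr // ler_pdivrMr //.
  by rewrite ![_ + 1]addrC lo up.
(* The equality holds by the choice of the error; the bounds with [eps = 1] serve for finiteness and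
   a nonzero denominator. *)
have eps01 : 0 < (1 : R) <= 1 by rewrite ltr01 lexx.
apply: filterS (near_bounds _ eps01) => N [S0 [S0gt L0 minE lo up]].
have phiE : phi k (Omega c N) (p N) (delta N)
    = (fine (phi k (Omega c N) (p N) (delta N)))%:E.
  rewrite fineK // fin_numElt (lt_le_trans _ lo) ?ltNyr //=.
  by rewrite (le_lt_trans up) // ltry.
have mE : m N = #|` S0|%:R by rewrite /m minE.
rewrite minE {1}phiE -EFinM -mE; congr _%:E.
rewrite [1 + _]addrC subrK -[RHS]mulrA divfK //.
by rewrite mulf_neq0 ?gt_eqF // mE ltr0n.
Qed.
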